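(* The evaluation problem for walk logic (WL) is non-elementary in data complexity. More precisely, for each integer $k \geq 1$ there exist a finite alphabet $\Sigma$ and a Boolean WL formula $\phi$ over $\Sigma$ such that the problem $\textsc{Eval}(\mathrm{WL},\phi)$ (given a data graph $G$ over $\Sigma$, decide whether $G \models \phi$) is $k$-$\textsc{Expspace}$-hard. Moreover, this hardness holds even when the input is restricted to graph databases.
   Context: A data graph over a finite alphabet $\Sigma$ is a tuple $G=(V,E,\kappa)$ with $V$ a finite set of nodes, $E \subseteq V\times\Sigma\times V$ a set of labeled directed edges, and $\kappa: V \to \mathcal{D}$ assigning to each node a data value from an infinite domain $\mathcal{D}$. A graph database is a data graph in which $\kappa$ is injective. A path in $G$ is a nonempty sequence $\rho = v_1 a_1 v_2 \cdots v_{n-1} a_{n-1} v_n$ with $(v_i,a_i,v_{i+1})\in E$ for all $i<n$; its positions are $1,\dots,n$. Walk logic (WL) over $\Sigma$ uses path variables $\pi,\pi_1,\dots$ and, for each path variable $\pi$, position variables of sort $\pi$ (written $t^\pi$). Formulas: $\phi ::= E_a(t_1^\pi,t_2^\pi) \mid t_1^\pi < t_2^\pi \mid t_1 \sim t_2 \mid \neg\phi \mid \phi\vee\phi \mid \exists t\,\phi \mid \exists \pi\,\phi$, where $a\in\Sigma$, $t_1^\pi,t_2^\pi$ have the same sort and $t_1,t_2$ may have any sorts. An assignment maps each relevant path variable $\pi$ to a path of $G$ and each position variable $t^\pi$ to a position of the path assigned to $\pi$. Semantics: $E_a(t_1^\pi,t_2^\pi)$ holds iff, with $\pi$ assigned $v_1a_1\cdots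 v_n$, the position of $t_2$ is the position of $t_1$ plus one and $a_{\text{pos}(t_1)}=a$; $t_1^\pi<t_2^\pi$ compares positions; $t_1\sim t_2$ holds iff the nodes at the positions assigned to $t_1$ and $t_2$ (in their respective paths) carry the same data value under $\kappa$; $\exists \pi\,\psi$ means there is a path of $G$ assigned to $\pi$ making $\psi$ true; $\exists t^\pi\,\psi$ means there is a position in the path of $\pi$ making $\psi$ true (and if $\pi$ is not free in $\psi$, also choosing a path for $\pi$); Boolean connectives are standard. A Boolean formula has no free variables. ''Data complexity'' means the formula $\phi$ is fixed and only $G$ is the input. $k$-$\textsc{Expspace}$ is the class of problems solvable in space bounded by a tower of $k$ exponentials of a polynomial in the input size. *)

(* Defs.v *)
From mathcomp Require Import all_boot.
Set Implicit Arguments. Unset Strict Implicit. Unset Printing Implicit Defensive.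

(* Data graphs over the alphabet Sigma = 'I_s, data domain D = nat.   *)
(* Nodes are 'I_dn; edges a subset of V x Sigma x V; kappa : V -> D.  *)
Record dgraph (s : nat) := DGraph {
  dn : nat;
  dE : {set ('I_dn * 'I_s * 'I_dn)};
  dk : 'I_dn -> nat }.

Definition is_database s (G : dgraph s) : Prop := injective (@dk s G).

(* A path v1 a1 v2 ... a_{n-1} v_n : first node and the list of (a_i, v_{i+1}). *)
Definition gpath s (G : dgraph s) : Type := ('I_(dn G) * seq ('I_s * 'I_(dn G)))%type.

Fixpoint valid_steps s (G : dgraph s) (v : 'I_(dn G)) (st : seq ('I_s * 'I_(dn G))) : bool :=
  match st with
  | [::] => true
  | (a, w) :: st' => ((v, a, w) \in dE G) && valid_steps w st'
  end.

Definition valid_path s (G : dgraph s) (p : gpath G) : bool := valid_steps p.1 p.2.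

(* number of positions; positions are 1, ..., plen p *)
Definition plen s (G : dgraph s) (p : gpath G) : nat := (size p.2).+1.

Definition pos_ok s (G : dgraph s) (p : gpath G) (i : nat) : bool := (1 <= i <= plen p).

(* node at position i (1-based) *)
Definition node_at s (G : dgraph s) (p : gpath G) (i : nat) : 'I_(dn G) :=
  if i <= 1 then p.1 else nth p.1 (map snd p.2) (i - 2).

Definition label_at s (G : dgraph s) (p : gpath G) (i : nat) : option 'I_s :=
  if (1 <= i) && (i < plen p) then ohead (drop (i - 1) (map fst p.2)) else None.

(* Walk logic syntax.  Path variables are nats; a position variable    *)
(* of sort pi is a pair (pi, i), written t_i^pi.                       *)
Inductive wl (s : nat) : Type :=
| WE   : 'I_s -> nat -> nat -> nat -> wl s        (* WE a pi i j  =  E_a(t_i^pi, t_j^pi) *)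
| WLt  : nat -> nat -> nat -> wl s               (* WLt pi i j   =  t_i^pi < t_j^pi     *)
| WSim : nat -> nat -> nat -> nat -> wl s        (* WSim pi i pi' j = t_i^pi ~ t_j^pi'  *)
| WNeg : wl s -> wl s
| WOr  : wl s -> wl s -> wl s
| WExPos : nat -> nat -> wl s -> wl s            (* exists t_i^pi, psi *)
| WExPath : nat -> wl s -> wl s.

Fixpoint closed_wl s (B : seq (nat * nat)) (f : wl s) : bool :=
  match f with
  | WE _ pi i j => ((pi, i) \in B) && ((pi, j) \in B)
  | WLt pi i j => ((pi, i) \in B) && ((pi, j) \in B)
  | WSim pi i pi' j => ((pi, i) \in B) && ((pi', j) \in B)
  | WNeg g => closed_wl B g
  | WOr g h => closed_wl B g && closed_wl B h
  | WExPos pi i g => closed_wl ((pi, i) :: B) g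
  | WExPath _ g => closed_wl B g
  end.

Definition boolean_wl s (f : wl s) : bool := closed_wl [::] f.

(* Assignments: rho gives the path of each currently assigned path variable,
   mu gives positions of position variables. *)
Definition upd_path s (G : dgraph s) (rho : nat -> option (gpath G)) (pi : nat) (p : gpath G) :=
  fun x => if x == pi then Some p else rho x.

Definition upd_pos (mu : nat -> nat -> nat) (pi i k : nat) :=
  fun x y => if (x == pi) && (y == i) then k else mu x y.

Fixpoint sat s (G : dgraph s) (rho : nat -> option (gpath G)) (mu : nat -> nat -> nat)
  (f : wl s) : Prop :=
  match f with
  | WE a pi i j =>
      exists p, rho pi = Some p /\ pos_ok p (mu pi i) /\ pos_ok p (mu pi j) /\
                mu pi j = (mu pi i).+1 /\ label_at p (mu pi i) = Some a
  | WLt pi i j =>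
      exists p, rho pi = Some p /\ pos_ok p (mu pi i) /\ pos_ok p (mu pi j) /\
                mu pi i < mu pi j
  | WSim pi i pi' j =>
      exists p p', rho pi = Some p /\ rho pi' = Some p' /\
                   pos_ok p (mu pi i) /\ pos_ok p' (mu pi' j) /\
                   dk (node_at p (mu pi i)) = dk (node_at p' (mu pi' j))
  | WNeg g => ~ sat rho mu g
  | WOr g h => sat rho mu g \/ sat rho mu h
  | WExPos pi i g =>
      match rho pi with
      | Some p => exists k, pos_ok p k /\ sat rho (upd_pos mu pi i k) g
      | None => exists p : gpath G, valid_path p /\
                  exists k, pos_ok p k /\ sat (upd_path rho pi p) (upd_pos mu pi i k) g
      end
  | WExPath pi g =>
      exists p : gpath G, valid_path p /\ sat (upd_path rho pi p) mu g
  end.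

Definition models s (G : dgraph s) (f : wl s) : Prop :=
  @sat s G (fun _ => None) (fun _ _ => 1) f.

(* Encoding of data graphs as bit strings (self-delimiting binary).    *)
Fixpoint bitsF (fuel m : nat) : seq bool :=
  match fuel with
  | 0 => [::]
  | fuel'.+1 => if m == 0 then [::] else odd m :: bitsF fuel' m./2
  end.
Definition bits (m : nat) : seq bool := bitsF m m.

Definition code (m : nat) : seq bool := flatten [seq [:: true; b] | b <- bits m] ++ [:: false].

Definition enc s (G : dgraph s) : seq bool :=
  code (dn G) ++ code #|dE G| ++
  flatten [seq code (nat_of_ord e.1.1) ++ code (nat_of_ord e.1.2) ++ code (nat_of_ord e.2)
          | e <- enum (dE G)] ++
  flatten [seq code (dk i) | i <- enum 'I_(dn G)].

Inductive move := MLeft | MStay | MRight.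

Record TM := MkTM {
  tm_st : finType;
  tm_sym : finType;
  tm_blank : tm_sym;
  tm_inp : bool -> tm_sym;
  tm_inp_inj : injective tm_inp;
  tm_inp_nb : forall b, tm_inp b != tm_blank;
  tm_q0 : tm_st;
  tm_qacc : tm_st;
  tm_qrej : tm_st;
  tm_acc_rej : tm_qacc != tm_qrej;
  tm_delta : tm_st -> tm_sym -> tm_st * tm_sym * move }.

Record config (M : TM) := Cfg { c_st : tm_st M; c_tape : nat -> tm_sym M; c_head : nat }.

Definition halted (M : TM) (c : config M) : bool :=
  (c_st c == tm_qacc M) || (c_st c == tm_qrej M).

Definition step (M : TM) (c : config M) : config M :=
  if halted c then c else
  let: (q', g, m) := tm_delta (c_st c) (c_tape c (c_head c)) in
  let tp := fun i => if i == c_head c then g else c_tape c i in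
  let h := match m with MLeft => (c_head c).-1 | MStay => c_head c | MRight => (c_head c).+1 end in
  Cfg q' tp h.

Definition init (M : TM) (w : seq bool) : config M :=
  Cfg (tm_q0 M) (fun i => if i < size w then tm_inp M (nth false w i) else tm_blank M) 0.

Definition run (M : TM) (w : seq bool) (t : nat) : config M := iter t (@step M) (init M w).

Definition decides_in_space (M : TM) (L : seq bool -> Prop) (S : nat -> nat) : Prop :=
  forall w,
    (exists t, halted (run M w t)) /\
    (forall t, c_head (run M w t) < S (size w)) /\
    (L w <-> exists t, c_st (run M w t) = tm_qacc M).

Fixpoint tower (k n : nat) : nat :=
  match k with 0 => n | k'.+1 => 2 ^ tower k' n end.

Definition kEXPSPACE (k : nat) (L : seq bool -> Prop) : Prop :=
  exists M c d, decides_in_space M L (fun n => tower k (c * n ^ d + c)).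

Definition ptime_computable (f : seq bool -> seq bool) : Prop :=
  exists M c d, forall w, exists t,
    t <= c * size w ^ d + c /\ halted (run M w t) /\
    (forall i, i < size (f w) -> c_tape (run M w t) i = tm_inp M (nth false (f w) i)) /\
    c_tape (run M w t) (size (f w)) = tm_blank M.

Definition kEXPSPACE_hard_on_databases (k s : nat) (phi : wl s) : Prop :=
  forall L, kEXPSPACE k L ->
    exists f, ptime_computable f /\
      forall w, exists G : dgraph s,
        is_database G /\ f w = enc G /\ (L w <-> models G phi).

(* Main.v *)
Require Import Defs.
From mathcomp Require Import all_boot zify.
From Stdlib Require Import FunctionalExtensionality Classical.
Set Implicit Arguments. Unset Strict Implicit. Unset Printing Implicit Defensive.

(** A path of the graph is used as a word that lists the successive configurations of a space-bounded
    machine [M], cell by cell: the node of a cell is a tile (a window of three neighbouring cells), and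
    two families of edges tell which tiles may be horizontal and vertical neighbours.  To find the cell
    below a given one, every cell is preceded by an address, namely a hereditarily finite set of depth
    [k] over atomic nodes, written with one marker node per level; there are [tower k A] of them over
    [A] atoms, and equality of two addresses is first-order expressible by [k] nested rounds of
    extensionality.  The formula never says that addresses are well formed: it only requires that the
    relation "next cell with the same address" relates the beginnings of the first two rows and is
    stable under moving both cells one step to the right.  Hence every path satisfying the formula is a
    run of [M], and well-formed addresses only matter for building a path from a run.  The machine
    and its input are encoded in the graph, so that the formula depends on [k] alone.

    The graph is printed in polynomial time by a program over registers holding bit lists; the
    registers are parallel tracks of one tape and every instruction is a single sweep over it. *)

(** * Register programs and their compilation to Turing machines *)

(** Since the formula is fixed, it can neither count up to the width of a row nor mention [M]:
    nesting depth is all that [k] buys, and the polynomial inside the space bound has to be absorbed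
    by the number of atoms, hence by the size of the graph.

    The width is therefore left open. A satisfying path fixes some width [W], possibly smaller than
    the space that [M] uses. This is harmless: a head that crosses the right border of the strip
    vanishes and can no longer accept. Conversely, an accepting run is laid out with [W] equal to
    the number of all addresses, which exceeds every head position.

    Data values are the node numbers themselves, so that the graph is a database and [~] is equality
    of nodes. The path that spells the run may pass from any node to any other; constraints between
    cells that are far apart on it are tested by a second path that crosses a single edge between
    the same two nodes. *)

Inductive regop := OPush of bool | OClear | OInc.

Fixpoint incb (l : seq bool) : seq bool :=
  match l with
  | [::] => [:: true]
  | false :: l' => true :: l'
  | true :: l' => false :: incb l'
  end.

Definition opf (o : regop) (l : seq bool) : seq bool :=
  match o with OPush b => rcons l b | OClear => [::] | OInc => incb l end.

(** The operation as an automaton that reads a register from index 0 upwards; the flag says that the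
    bit is still to be placed, or that a carry is pending. *)
Definition ostep (o : regop) (p : bool) (x : option bool) : bool * option bool :=
  match o with
  | OPush b => if p && (x == None) then (false, Some b) else (p, x)
  | OClear => (p, None)
  | OInc => if p then (if x == Some true then (true, Some false) else (false, Some true))
            else (p, x)
  end.

Definition column := nat -> option bool.
Definition regs := seq (seq bool).

(* A column is what the registers hold at one index; the tests of [PIf] and [PWhile] ask whether at
   least a given number of columns satisfy a predicate. *)
Inductive prog :=
| POp of regop & nat
| PSeq of prog & prog
| PIf of (column -> bool) & nat & prog & prog
| PWhile of (column -> bool) & nat & prog.

Definition headcol (f : nat -> seq bool) : column := fun r => ohead (f r).
Definition tailcol (f : nat -> seq bool) : nat -> seq bool := fun r => behead (f r).

Fixpoint cntL (phi : column -> bool) (f : nat -> seq bool) (L : nat) : nat :=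
  match L with
  | 0 => 0
  | L'.+1 => phi (headcol f) + cntL phi (tailcol f) L'
  end.

Definition fits (s : regs) (L : nat) := forall r, size (nth [::] s r) <= L.

(** The outcome must be the same for every length that holds all registers, because the tape grows
    during the run and ends in empty columns. *)
Definition test_is (phi : column -> bool) (c : nat) (s : regs) (b : bool) :=
  forall L, fits s L -> (c <= cntL phi (nth [::] s) L) = b.

(* The last argument counts the sweeps over the tape. *)
Inductive exec : prog -> regs -> regs -> nat -> Prop :=
| EOp o r s : exec (POp o r) s (set_nth [::] s r (opf o (nth [::] s r))) 1
| ESeq p q s1 s2 s3 m1 m2 :
    exec p s1 s2 m1 -> exec q s2 s3 m2 -> exec (PSeq p q) s1 s3 (m1 + m2)
| EIf phi c p q s b s' m :
    test_is phi c s b -> exec (if b then p else q) s s' m -> exec (PIf phi c p q) s s' m.+1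
| EWhileF phi c p s : test_is phi c s false -> exec (PWhile phi c p) s s 1
| EWhileT phi c p s1 s2 s3 m1 m2 :
    test_is phi c s1 true -> exec p s1 s2 m1 -> exec (PWhile phi c p) s2 s3 m2 ->
    exec (PWhile phi c p) s1 s3 (m1 + m2).+1.

Fixpoint maxreg (p : prog) : nat :=
  match p with
  | POp _ r => r
  | PSeq p q => maxn (maxreg p) (maxreg q)
  | PIf _ _ p q => maxn (maxreg p) (maxreg q)
  | PWhile _ _ p => maxreg p
  end.

(** * Machines with exits, and the compilation of programs *)

Section Compile.
Variable R : nat.

Definition cell : finType := {ffun 'I_R -> option bool}.
(** Blank, a bit of the input or output, or a flagged column of all registers. *)
Definition tsym : finType := option (bool + bool * cell)%type.
Definition tape := nat -> tsym.
Definition cell0 : cell := [ffun _ => None].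

(** The boolean is an exit that carries the result of a test; composition redirects exits to initial
    states of other machines. *)
Record omach := Om {
  oQ : finType;
  o0 : oQ;
  od : oQ -> tsym -> (oQ + bool)%type * tsym * move }.

Definition wr (tp : tape) (h : nat) (g : tsym) : tape := fun i => if i == h then g else tp i.
Definition mvh (m : move) (h : nat) : nat :=
  match m with MLeft => h.-1 | MStay => h | MRight => h.+1 end.

Inductive oreach (M : omach) : nat -> (oQ M + bool)%type -> tape -> nat ->
    (oQ M + bool)%type -> tape -> nat -> Prop :=
| OR0 a tp h : oreach 0 a tp h a tp h
| ORS n q tp h r g m b tp' h' : od q (tp h) = (r, g, m) ->
    oreach n r (wr tp h g) (mvh m h) b tp' h' -> oreach n.+1 (inl q) tp h b tp' h'.

Lemma oreach_trans M n1 n2 a b c tp1 tp2 tp3 h1 h2 h3 :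
  @oreach M n1 a tp1 h1 b tp2 h2 -> oreach n2 b tp2 h2 c tp3 h3 ->
  oreach (n1 + n2) a tp1 h1 c tp3 h3.
Proof.
elim=> // n q tp h r g m b' tp' h' e _ IH /IH; rewrite addSn; exact: ORS.
Qed.

(** All compositions below are instances: [F] embeds the states of a component and sends its exits
    wherever the compound continues. *)
Lemma oreach_map (M M' : omach) (F : oQ M + bool -> oQ M' + bool) :
  (forall q, exists2 q', F (inl q) = inl q' &
     forall y, od q' y = (F (od q y).1.1, (od q y).1.2, (od q y).2)) ->
  forall n a tp h b tp' h', oreach n a tp h b tp' h' -> oreach n (F a) tp h (F b) tp' h'.
Proof.
move=> HF n a tp h b tp' h'; elim=> [*|]; first exact: OR0.
move=> {}n q {}tp {}h r g m {}b {}tp' {}h' e _ IH.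
have [q' -> Hq'] := HF q; apply: ORS IH; by rewrite Hq' e.
Qed.

Definition oseq (M N : omach) : omach :=
  @Om (oQ M + oQ N)%type (inl (o0 M)) (fun q y =>
    match q with
    | inl q => let: (r, g, m) := od q y in
        (match r with inl r => inl (inl r) | inr _ => inl (inr (o0 N)) end, g, m)
    | inr q => let: (r, g, m) := od q y in
        (match r with inl r => inl (inr r) | inr b => inr b end, g, m)
    end).

Lemma oseq_reach M N n1 n2 tp1 tp2 tp3 h1 h2 h3 b1 b2 :
  oreach n1 (inl (o0 M)) tp1 h1 (inr b1) tp2 h2 ->
  oreach n2 (inl (o0 N)) tp2 h2 (inr b2) tp3 h3 ->
  oreach (M := oseq M N) (n1 + n2) (inl (o0 (oseq M N))) tp1 h1 (inr b2) tp3 h3.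
Proof.
move=> H1 H2; apply: (@oreach_trans (oseq M N) _ _ _ (inl (inr (o0 N)))).
  pose F (r : oQ M + bool) : oQ (oseq M N) + bool :=
    match r with inl r => inl (inl r) | inr _ => inl (inr (o0 N)) end.
  apply: (@oreach_map M (oseq M N) F _ _ _ _ _ _ _ _ H1) => q; exists (inl q) => //= y.
  by case: (od q y) => [[]].
pose F (r : oQ N + bool) : oQ (oseq M N) + bool :=
  match r with inl r => inl (inr r) | inr b => inr b end.
apply: (@oreach_map N (oseq M N) F _ _ _ _ _ _ _ _ H2) => q; exists (inr q) => //= y.
by case: (od q y) => [[]].
Qed.

Definition oif (T M N : omach) : omach :=
  @Om (oQ T + (oQ M + oQ N))%type (inl (o0 T)) (fun q y =>
    match q with
    | inl q => let: (r, g, m) := od q y in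
        (match r with
         | inl r => inl (inl r)
         | inr b => inl (inr (if b then inl (o0 M) else inr (o0 N))) end, g, m)
    | inr (inl q) => let: (r, g, m) := od q y in
        (match r with inl r => inl (inr (inl r)) | inr b => inr b end, g, m)
    | inr (inr q) => let: (r, g, m) := od q y in
        (match r with inl r => inl (inr (inr r)) | inr b => inr b end, g, m)
    end).

Lemma oif_reach T M N n1 n2 tp1 tp2 tp3 h1 h2 h3 (b b2 : bool) :
  oreach n1 (inl (o0 T)) tp1 h1 (inr b) tp2 h2 ->
  oreach n2 (inl (o0 (if b then M else N))) tp2 h2 (inr b2) tp3 h3 ->
  oreach (M := oif T M N) (n1 + n2) (inl (o0 (oif T M N))) tp1 h1 (inr b2) tp3 h3.
Proof.
move=> H1 H2; apply: (@oreach_trans (oif T M N) _ _ _ (inl (inr (if b then inl (o0 M) else inr (o0 N))))).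
  pose F (r : oQ T + bool) : oQ (oif T M N) + bool :=
    match r with inl r => inl (inl r)
    | inr b => inl (inr (if b then inl (o0 M) else inr (o0 N))) end.
  apply: (@oreach_map T (oif T M N) F _ _ _ _ _ _ _ _ H1) => q; exists (inl q) => //= y.
  by case: (od q y) => [[]].
case: b H1 H2 => H1 H2.
  pose F (r : oQ M + bool) : oQ (oif T M N) + bool :=
    match r with inl r => inl (inr (inl r)) | inr b => inr b end.
  apply: (@oreach_map M (oif T M N) F _ _ _ _ _ _ _ _ H2) => q; exists (inr (inl q)) => //= y.
  by case: (od q y) => [[]].
pose F (r : oQ N + bool) : oQ (oif T M N) + bool :=
  match r with inl r => inl (inr (inr r)) | inr b => inr b end.
apply: (@oreach_map N (oif T M N) F _ _ _ _ _ _ _ _ H2) => q; exists (inr (inr q)) => //= y.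
by case: (od q y) => [[]].
Qed.

Definition owhile (T M : omach) : omach :=
  @Om (oQ T + oQ M)%type (inl (o0 T)) (fun q y =>
    match q with
    | inl q => let: (r, g, m) := od q y in
        (match r with
         | inl r => inl (inl r)
         | inr b => if b then inl (inr (o0 M)) else inr true end, g, m)
    | inr q => let: (r, g, m) := od q y in
        (match r with inl r => inl (inr r) | inr b => inl (inl (o0 T)) end, g, m)
    end).

Lemma owhile_test T M n tp1 tp2 h1 h2 (b : bool) :
  oreach n (inl (o0 T)) tp1 h1 (inr b) tp2 h2 ->
  oreach (M := owhile T M) n (inl (o0 (owhile T M))) tp1 h1
    (if b then inl (inr (o0 M)) else inr true) tp2 h2.
Proof.
move=> H.
pose F (r : oQ T + bool) : oQ (owhile T M) + bool :=
  match r with inl r => inl (inl r) | inr b => if b then inl (inr (o0 M)) else inr true end.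
apply: (@oreach_map T (owhile T M) F _ _ _ _ _ _ _ _ H) => q; exists (inl q) => //= y.
by case: (od q y) => [[]].
Qed.

Lemma owhile_body T M n tp1 tp2 h1 h2 b :
  oreach n (inl (o0 M)) tp1 h1 (inr b) tp2 h2 ->
  oreach (M := owhile T M) n (inl (inr (o0 M))) tp1 h1 (inl (o0 (owhile T M))) tp2 h2.
Proof.
move=> H.
pose F (r : oQ M + bool) : oQ (owhile T M) + bool :=
  match r with inl r => inl (inr r) | inr b => inl (inl (o0 T)) end.
apply: (@oreach_map M (owhile T M) F _ _ _ _ _ _ _ _ H) => q; exists (inr q) => //= y.
by case: (od q y) => [[]].
Qed.

(* The flag marks cell 0, so that a head moving left can stop there. *)
Definition tpw (x : seq cell) : tape :=
  fun i => if i < size x then Some (inr (i == 0, nth cell0 x i)) else None.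

(** * One sweep of a finite-state transducer over the tape *)

Section Sweep.
Variables (S : finType) (s0 : S) (st : S -> cell -> S * cell) (res : S -> bool).

Fixpoint mrun (s : S) (x : seq cell) : S * seq cell :=
  match x with
  | [::] => (s, [::])
  | c :: x' => let: (s1, c1) := st s c in let: (s2, x2) := mrun s1 x' in (s2, c1 :: x2)
  end.

(** The first blank is treated as one more empty column and joins the tape, so that each sweep
    lengthens the tape by one; a push or a carry may need this column. *)
Definition osweep : omach :=
  @Om (S + bool)%type (inl s0) (fun q y =>
    match q, y with
    | inl s, Some (inr (f, c)) => (inl (inl (st s c).1), Some (inr (f, (st s c).2)), MRight)
    | inl s, _ => (inl (inr (res (st s cell0).1)), Some (inr (false, (st s cell0).2)), MLeft)
    | inr b, Some (inr (true, c)) => (inr b, y, MStay)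
    | inr b, _ => (inl (inr b), y, MLeft)
    end).

Lemma wr_tpw y1 c c' x :
  wr (tpw (y1 ++ c :: x)) (size y1) (Some (inr (size y1 == 0, c'))) = tpw (y1 ++ c' :: x).
Proof.
apply: functional_extensionality => i; rewrite /wr /tpw !size_cat /=.
case: eqP => [->|/eqP ne]; first by rewrite ltnNge -[X in _ <= X]addn0 leq_add2l /= nth_cat ltnn subnn.
rewrite !nth_cat; case: (ltnP i (size y1)) => // h.
by case: ltnP => // h2; rewrite -[i - size y1](@prednK) // subn_gt0 ltn_neqAle eq_sym ne h.
Qed.

Lemma wr_tpw_end y c : 0 < size y -> wr (tpw y) (size y) (Some (inr (false, c))) = tpw (rcons y c).
Proof.
move=> h; apply: functional_extensionality => i; rewrite /wr /tpw size_rcons nth_rcons.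
case: eqP => [->|/eqP ne]; first by rewrite leqnn ltnn; case: (size y) h.
by rewrite ltnS (leq_eqVlt i) (negbTE ne) /=; case: ltnP.
Qed.

Lemma wr_id tp h : wr tp h (tp h) = tp.
Proof. by apply: functional_extensionality => i; rewrite /wr; case: eqP => // ->. Qed.

Lemma sweep_right x : forall y s,
  oreach (M := osweep) (size x) (inl (inl s)) (tpw (y ++ x)) (size y)
    (inl (inl (mrun s x).1)) (tpw (y ++ (mrun s x).2)) (size y + size x).
Proof.
elim: x => [|c x IH] y s /=; first by rewrite addn0; apply: OR0.
have e : tpw (y ++ c :: x) (size y) = Some (inr (size y == 0, c)).
  by rewrite /tpw size_cat /= nth_cat ltnn subnn /= addnS leq_addr.
case ec: (st s c) => [s1 c1]; case em: (mrun s1 x) => [s2 x2] /=.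
have := IH (rcons y c1) s1; rewrite em /= size_rcons !cat_rcons addSnnS => H.
by apply: ORS; [rewrite e /= ec; reflexivity | rewrite wr_tpw].
Qed.

Lemma sweep_left x b h : h < size x ->
  oreach (M := osweep) h.+1 (inl (inr b)) (tpw x) h (inr b) (tpw x) 0.
Proof.
elim: h => [|h IH] hx.
  have e : tpw x 0 = Some (inr (true, nth cell0 x 0)) by rewrite /tpw hx.
  apply: ORS; first by rewrite /= e.
  by rewrite -e wr_id /=; apply: OR0.
have e : tpw x h.+1 = Some (inr (false, nth cell0 x h.+1)) by rewrite /tpw hx.
apply: ORS; first by rewrite /= e.
by rewrite -e wr_id /=; apply: IH; apply: ltnW.
Qed.

Lemma sweep_reach x s' x' : 0 < size x -> mrun s0 (rcons x cell0) = (s', x') ->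
  oreach (M := osweep) (2 * size x).+1 (inl (o0 osweep)) (tpw x) 0 (inr (res s')) (tpw x') 0.
Proof.
move=> hx.
have mrun_rcons : forall y s c, mrun s (rcons y c) =
    ((st (mrun s y).1 c).1, rcons (mrun s y).2 (st (mrun s y).1 c).2).
  elim=> [|a y IH] s c /=; first by case: (st s c).
  case: (st s a) => s1 a1; rewrite IH.
  by case: (mrun s1 y) => s2 y2 /=.
have size_mrun : forall y s, size (mrun s y).2 = size y.
  elim=> [|a y IH] s //=; case: (st s a) => s1 a1; have := IH s1.
  by case: (mrun s1 y) => ? ? /= ->.
rewrite mrun_rcons => -[<- <-].
(* [size x] steps to the right, one on the blank, [size x] back to the flagged cell. *)
have -> : (2 * size x).+1 = size x + (1 + size x) by lia.
apply: (oreach_trans (sweep_right x [::] s0)); rewrite /= add0n.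
have e : tpw (mrun s0 x).2 (size x) = None by rewrite /tpw size_mrun ltnn.
apply: ORS; first by rewrite /= e.
rewrite -[in wr _ (size x)](size_mrun x s0) wr_tpw_end ?size_mrun //= -{1}(prednK hx).
by apply: sweep_left; rewrite size_rcons size_mrun; case: (size x) hx.
Qed.

End Sweep.

Definition viewc (c : cell) : column := fun r => if insub r is Some j then c j else None.

Definition topc (f : nat -> seq bool) : cell := [ffun r : 'I_R => headcol f r].

Fixpoint word (f : nat -> seq bool) (L : nat) : seq cell :=
  match L with 0 => [::] | L'.+1 => topc f :: word (tailcol f) L' end.

Lemma size_word f L : size (word f L) = L.
Proof. by elim: L f => //= L IH f; rewrite IH. Qed.

Lemma word_rcons L : forall f, (forall r, size (f r) <= L) -> word f L.+1 = rcons (word f L) cell0.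
Proof.
elim: L => [|L IH] f hf.
  by congr (_ :: _); apply/ffunP => r; rewrite !ffunE /headcol; case: (f r) (hf r).
rewrite [LHS]/= -/(word (tailcol f) L.+1) IH //= => r.
by rewrite /tailcol size_behead; have := hf r; lia.
Qed.

Definition setc (c : cell) (r : nat) (x : option bool) : cell :=
  [ffun j : 'I_R => if (j : nat) == r then x else c j].

Definition opst (o : regop) (r : nat) (p : bool) (c : cell) : bool * cell :=
  ((ostep o p (viewc c r)).1, setc c r (ostep o p (viewc c r)).2).

Definition oop (o : regop) (r : nat) : omach := osweep true (opst o r) (fun _ => true).

Definition updf (f : nat -> seq bool) (r : nat) (l : seq bool) : nat -> seq bool :=
  fun i => if i == r then l else f i.

(** What happens to the rest of a register when the automaton [ostep] arrives with flag [p]. *)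
Definition opfp (o : regop) (p : bool) (l : seq bool) : seq bool :=
  if p then opf o l else if o is OClear then [::] else l.

Lemma viewc_topc f r : r < R -> viewc (topc f) r = ohead (f r).
Proof. by move=> hr; rewrite /viewc insubT ffunE. Qed.

(** The premise guarantees an empty column in which a pending push or carry can end; clearing needs
    none. *)
Lemma mrun_op o r (hr : r < R) L : forall f (p : bool),
  (p -> if o is OClear then true else size (f r) < L) ->
  (mrun (opst o r) p (word f L)).2 = word (updf f r (opfp o p (f r))) L.
Proof.
elim: L => [|L IH] f p hp //=.
rewrite /opst viewc_topc //.
set q := ostep o p (ohead (f r)).
have e1 : setc (topc f) r q.2 = topc (updf f r (opfp o p (f r))).
  apply/ffunP => j; rewrite !ffunE /headcol /updf; case: eqP => // _.
  rewrite /q {IH hp q}; move: (f r) => l.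
  by case: o p => [b||] [] //=; case: l => [|[] l].
have e2 : tailcol (updf f r (opfp o p (f r))) = updf (tailcol f) r (opfp o q.1 (tailcol f r)).
  apply: functional_extensionality => j; rewrite /tailcol /updf; case: eqP => // _.
  rewrite /q {IH hp e1 q}; move: (f r) => l.
  by case: o p => [b||] [] //=; case: l => [|[] l].
have h : q.1 -> if o is OClear then true else size (tailcol f r) < L.
  move: hp; rewrite /q /tailcol size_behead {IH e1 e2 q}; case: (f r) => [|b l] /=.
    by case: o p => [b||] [].
  by case: o p => [c||] [] //= /(_ isT) //; case: b.
have := IH (tailcol f) q.1 h; rewrite -/(opst o r) /=.
case: (mrun _ _ _) => s2 x2 /= ->.
by rewrite e1 e2.
Qed.

(** The count saturates at [c], so that finitely many states suffice. *)
Definition tstep (phi : column -> bool) (c : nat) (q : 'I_c.+1) (x : cell) : 'I_c.+1 * cell :=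
  (if phi (viewc x) then inord (minn c q.+1) else q, x).

Definition otest (phi : column -> bool) (c : nat) : omach :=
  osweep ord0 (@tstep phi c) (fun q => (q : nat) == c).

Lemma mrun_test phi c L : forall f q, (forall r, R <= r -> f r = [::]) ->
  (mrun (@tstep phi c) q (word f L)).2 = word f L /\
  ((mrun (@tstep phi c) q (word f L)).1 : nat) = minn c (q + cntL phi f L).
Proof.
elim: L => [|L IH] f q hf /=.
  by rewrite addn0; split=> //; apply/esym/minn_idPr; rewrite -ltnS.
have e : viewc (topc f) = headcol f.
  apply: functional_extensionality => r; case: (ltnP r R) => h; first by rewrite viewc_topc.
  by rewrite /viewc insubF ?ltnNge ?h // /headcol hf.
rewrite e.
set q1 := (if phi _ then _ else q).
have hq1 : (q1 : nat) = minn c (q + phi (headcol f)).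
  rewrite /q1; case: (phi _); first by rewrite inordK ?addn1 // ltnS geq_minl.
  by rewrite addn0; apply/esym/minn_idPr; rewrite -ltnS.
have [] := IH (tailcol f) q1 => [r hr|]; first by rewrite /tailcol hf.
case: (mrun _ _ _) => s2 x2 /= -> ->; split=> //.
rewrite hq1; lia.
Qed.

Fixpoint compile (p : prog) : omach :=
  match p with
  | POp o r => oop o r
  | PSeq p q => oseq (compile p) (compile q)
  | PIf phi c p q => oif (otest phi c) (compile p) (compile q)
  | PWhile phi c p => owhile (otest phi c) (compile p)
  end.

Notation wordr s L := (word (nth [::] s) L).

Lemma otest_reach phi c s b L : test_is phi c s b -> size s <= R -> 0 < L -> fits s L ->
  oreach (2 * L).+1 (inl (o0 (otest phi c))) (tpw (wordr s L)) 0
    (inr b) (tpw (wordr s L.+1)) 0.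
Proof.
move=> ht hs hL hf.
have hn r : R <= r -> nth [::] s r = [::] by move=> h; rewrite nth_default // (leq_trans hs).
case e: (mrun (@tstep phi c) ord0 (wordr s L.+1)) => [q x].
have [] := @mrun_test phi c L.+1 (nth [::] s) ord0 hn; rewrite e /= => ex eq.
have hf' : fits s L.+1 by move=> r; apply: leqW; apply: hf.
have -> : b = (q == c :> nat).
  by rewrite -(ht L.+1 hf') eq add0n; apply/idP/eqP; rewrite /=; lia.
rewrite -ex -{1}(size_word (nth [::] s) L).
by apply: (@sweep_reach _ _ _ (fun q : 'I_c.+1 => q == c :> nat)); rewrite ?size_word // -word_rcons.
Qed.

Lemma oop_reach o r s L : r < R -> 0 < L -> fits s L ->
  oreach (2 * L).+1 (inl (o0 (oop o r))) (tpw (wordr s L)) 0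
    (inr true) (tpw (wordr (set_nth [::] s r (opf o (nth [::] s r))) L.+1)) 0.
Proof.
move=> hr hL hf.
case e: (mrun (opst o r) true (wordr s L.+1)) => [q x].
have := @mrun_op o r hr L.+1 (nth [::] s) true; rewrite e => /= ex.
have -> : nth [::] (set_nth [::] s r (opf o (nth [::] s r))) = updf (nth [::] s) r (opfp o true (nth [::] s r)).
  by apply: functional_extensionality => j; rewrite nth_set_nth.
rewrite -ex; last by case: (o) => *; rewrite ?ltnS.
rewrite -{1}(size_word (nth [::] s) L).
apply: (@sweep_reach _ _ _ (fun _ => true) _ q); rewrite ?size_word //.
by rewrite -word_rcons.
Qed.

Lemma size_opf o l : size (opf o l) <= (size l).+1.
Proof.
case: o => [b||] //=; first by rewrite size_rcons.
by elim: l => [|[] l IH] //=; rewrite ltnS.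
Qed.

(** Each sweep lengthens the tape by one column and a register by at most one bit. Hence [m] sweeps
    end on [L + m] columns, and none of them takes more than [2 * (L + m) + 1] steps. *)
Lemma compile_reach p s s' m : exec p s s' m -> maxreg p < R -> size s <= R ->
  forall L, 0 < L -> fits s L ->
  [/\ size s' <= R, fits s' (L + m) & exists t b, t <= m * (2 * (L + m) + 1) /\
  oreach t (inl (o0 (compile p))) (tpw (wordr s L)) 0 (inr b) (tpw (wordr s' (L + m))) 0].
Proof.
elim=> {p s s' m}.
- move=> o r s /= hr hs L hL hf; rewrite addn1; split.
  + by rewrite size_set_nth; lia.
  + move=> i; rewrite nth_set_nth /=; case: eqP => _; last exact/leqW/hf.
    by apply: (leq_trans (size_opf _ _)); rewrite ltnS; apply: hf.
  + exists (2 * L).+1, true; split; first by lia.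
    exact: oop_reach.
- move=> p q s1 s2 s3 m1 m2 _ IH1 _ IH2 /=; rewrite gtn_max => /andP[hp hq] hs L hL hf.
  have [hs2 hf2 [t1 [b1 [ht1 H1]]]] := IH1 hp hs L hL hf.
  have [hs3 hf3 [t2 [b2 [ht2 H2]]]] := IH2 hq hs2 _ (ltn_addr m1 hL) hf2.
  rewrite addnA; split=> //; exists (t1 + t2), b2; split; first by nia.
  exact: oseq_reach H1 H2.
- move=> phi c p q s b s' m ht _ IH /=; rewrite gtn_max => /andP[hp hq] hs L hL hf.
  have H1 := otest_reach ht hs hL hf.
  have hf' : fits s L.+1 by move=> r; apply: leqW; apply: hf.
  have hb : maxreg (if b then p else q) < R by case: (b).
  have [hs2 hf2 [t2 [b2 [ht2 H2]]]] := IH hb hs L.+1 isT hf'.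
  rewrite addnS -addSn; split=> //; exists ((2 * L).+1 + t2), b2; split; first by nia.
  by apply: oif_reach H1 _; case: (b) H2.
- move=> phi c p s ht /= hp hs L hL hf; rewrite addn1; split=> //.
    by move=> r; apply: leqW; apply: hf.
  exists (2 * L).+1, true; split; first by lia.
  exact: owhile_test (otest_reach ht hs hL hf).
- move=> phi c p s1 s2 s3 m1 m2 ht _ IH1 _ IH2 /= hp hs L hL hf.
  have H0 := owhile_test (compile p) (otest_reach ht hs hL hf).
  have hf' : fits s1 L.+1 by move=> r; apply: leqW; apply: hf.
  have [hs2 hf2 [t1 [b1 [ht1 H1]]]] := IH1 hp hs L.+1 isT hf'.
  have [hs3 hf3 [t2 [b2 [ht2 H2]]]] := IH2 hp hs2 (L.+1 + m1) isT hf2.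
  rewrite addnS -addSn addnA; split=> //; exists ((2 * L).+1 + (t1 + t2)), b2; split; first by nia.
  apply: oreach_trans H0 _.
  exact: oreach_trans (owhile_body (otest phi c) H1) H2.
Qed.

(** * Loading the input and releasing the output *)

Definition ldc (b : bool) : cell := [ffun r : 'I_R => if (r : nat) == 0 then Some b else None].

(** State 0 reads cell 0, state 1 moves right, state 2 returns. The first blank also becomes an
    empty column, so that the tape has a flagged cell even for the empty input. *)
Definition oload : omach :=
  @Om 'I_3 ord0 (fun q y =>
    match val q, y with
    | 0, Some (inl b) => (inl (inord 1), Some (inr (true, ldc b)), MRight)
    | 0, _ => (inr true, Some (inr (true, cell0)), MStay)
    | 1, Some (inl b) => (inl (inord 1), Some (inr (false, ldc b)), MRight)
    | 1, _ => (inl (inord 2), Some (inr (false, cell0)), MLeft)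
    | _, Some (inr (true, c)) => (inr true, y, MStay)
    | _, _ => (inl (inord 2), y, MLeft)
    end).

Definition tpi (w : seq bool) : tape := fun i => if i < size w then Some (inl (nth false w i)) else None.

Definition tpm (x : seq cell) (w : seq bool) : tape :=
  fun i => if i < size x then tpw x i else tpi w (i - size x).

Lemma wr_tpm x b w c :
  wr (tpm x (b :: w)) (size x) (Some (inr (size x == 0, c))) = tpm (rcons x c) w.
Proof.
apply: functional_extensionality => i; rewrite /wr /tpm /tpw size_rcons nth_rcons.
case: eqP => [->|/eqP ne]; first by rewrite leqnn ltnn.
rewrite !ltnS (leq_eqVlt i) (negbTE ne) /=; case: (ltnP i (size x)) => // h.
rewrite subnS -[i - size x](@prednK) //; first by rewrite subn_gt0 ltn_neqAle eq_sym ne h.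
Qed.

Lemma oload_right w : forall x, 0 < size x ->
  oreach (M := oload) (size w) (inl (inord 1)) (tpm x w) (size x)
    (inl (inord 1)) (tpm (x ++ map ldc w) [::]) (size x + size w).
Proof.
elim: w => [|b w IH] x hx /=; first by rewrite cats0 addn0; apply: OR0.
have e : tpm x (b :: w) (size x) = Some (inl b) by rewrite /tpm ltnn subnn.
apply: ORS; first by rewrite /= e inordK.
have := wr_tpm x b w (ldc b); case: (size x =P 0) hx => [->//|_ hx ->].
rewrite -cat_rcons /= addnS -addSn -(size_rcons x (ldc b)); apply: IH.
by rewrite size_rcons.
Qed.

Lemma oload_left x h : h < size x ->
  oreach (M := oload) h.+1 (inl (inord 2)) (tpw x) h (inr true) (tpw x) 0.
Proof.
elim: h => [|h IH] hx.
  have e : tpw x 0 = Some (inr (true, nth cell0 x 0)) by rewrite /tpw hx.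
  apply: ORS; first by rewrite /= e inordK.
  by rewrite -e wr_id /=; apply: OR0.
have e : tpw x h.+1 = Some (inr (false, nth cell0 x h.+1)) by rewrite /tpw hx.
apply: ORS; first by rewrite /= e inordK.
by rewrite -e wr_id /=; apply: IH; apply: ltnW.
Qed.

Lemma tpm_nil x : tpm x [::] = tpw x.
Proof.
by apply: functional_extensionality => i; rewrite /tpm; case: ltnP => // h; rewrite /tpw ltnNge h.
Qed.

Lemma word_load w : wordr [:: w] (size w).+1 = rcons (map ldc w) cell0.
Proof.
rewrite word_rcons; last by case=> [|[|r]].
congr rcons.
have H : forall w (f : nat -> seq bool), f 0 = w -> (forall r, f r.+1 = [::]) ->
    word f (size w) = map ldc w.
  elim=> [|b v IH] f h0 h1 //=; rewrite IH ?/tailcol ?h0 // => [|r]; last by rewrite h1.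
  congr (_ :: _); apply/ffunP => r; rewrite !ffunE /headcol; case: eqP => [->|]; rewrite ?h0 //.
  by case: (nat_of_ord r) => // r' _; rewrite h1.
by apply: H => // -[].
Qed.

Lemma oload_reach w :
  oreach (M := oload) (2 * size w).+1 (inl (o0 oload)) (tpi w) 0
    (inr true) (tpw (wordr [:: w] (size w).+1)) 0.
Proof.
rewrite word_load; case: w => [|b w] /=.
  apply: ORS; first by rewrite /=.
  have -> : wr (tpi [::]) 0 (Some (inr (true, cell0))) = tpw [:: cell0].
    by apply: functional_extensionality => -[].
  exact: OR0.
apply: (@ORS oload _ _ _ _ (inl (inord 1)) (Some (inr (true, ldc b))) MRight) => //.
have -> : wr (tpi (b :: w)) 0 (Some (inr (true, ldc b))) = tpm [:: ldc b] w.
  by apply: functional_extensionality => -[|i] //=; rewrite /wr /tpm /= subn1.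
have -> : 2 * (size w).+1 = size w + (size w).+2 by lia.
apply: (oreach_trans (oload_right w (x := [:: ldc b]) isT)).
rewrite /= tpm_nil add1n.
have e : tpw (ldc b :: map ldc w) (size w).+1 = None by rewrite /tpw /= size_map ltnn.
apply: ORS; first by rewrite /= e inordK.
have := @wr_tpw_end (ldc b :: map ldc w) cell0 isT; rewrite /= size_map => -> /=.
by apply: oload_left; rewrite /= size_rcons size_map ltnS.
Qed.

(** Only one blank is written behind the output; what stands further right is left as it is, which
    [ptime_computable] allows. *)
Definition oout : omach :=
  @Om unit tt (fun _ y =>
    match y with
    | Some (inr (_, c)) => if viewc c 1 is Some b then (inl tt, Some (inl b), MRight)
                           else (inr true, None, MStay)
    | _ => (inr true, None, MStay)
    end).

Lemma oout_reach f L tp h : 1 < R -> size (f 1) <= L -> tp (h + L) = None ->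
  (forall i, i < L -> exists fl, tp (h + i) = Some (inr (fl, nth cell0 (word f L) i))) ->
  exists tp' h', [/\ oreach (M := oout) (size (f 1)).+1 (inl tt) tp h (inr true) tp' h',
    forall i, i < size (f 1) -> tp' (h + i) = Some (inl (nth false (f 1) i)),
    tp' (h + size (f 1)) = None & forall i, i < h -> tp' i = tp i].
Proof.
move=> hR; elim: L f tp h => [|L IH] f tp h hf hL htp.
  case: (f 1) hf => // _; exists (wr tp h None), h; split=> //; last 2 first.
  - by rewrite addn0 /wr eqxx.
  - by move=> i hi; rewrite /wr; case: eqP hi => // ->; rewrite ltnn.
  apply: (@ORS oout _ _ _ _ (inr true) None MStay); first by rewrite -[h]addn0 hL.
  exact: OR0.
have [fl] := htp 0 isT; rewrite addn0 /= => e0.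
have ev : viewc (topc f) 1 = ohead (f 1) by rewrite viewc_topc.
case ef: (f 1) hf ev => [|b l] /= hf ev.
  exists (wr tp h None), h; split=> //; last 2 first.
  - by rewrite addn0 /wr eqxx.
  - by move=> i hi; rewrite /wr; case: eqP hi => // ->; rewrite ltnn.
  apply: (@ORS oout _ _ _ _ (inr true) None MStay); first by rewrite e0 /= ev.
  exact: OR0.
have et : tailcol f 1 = l by rewrite /tailcol ef.
have [|||tp' [h' [H1 H2 H3 H4]]] := IH (tailcol f) (wr tp h (Some (inl b))) h.+1.
- by rewrite et.
- by rewrite /wr addSnnS hL; case: eqP => //; lia.
- move=> i hi; have [fl' e'] := htp i.+1 hi; exists fl'.
  by rewrite /wr addSnnS e'; case: eqP => //; lia.
rewrite et in H1 H2 H3.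
exists tp', h'; split.
- apply: (@ORS oout _ _ _ _ (inl tt) (Some (inl b)) MRight); first by rewrite e0 /= ev.
  exact: H1.
- case=> [_|i hi]; first by rewrite addn0 H4 // /wr eqxx.
  by rewrite -addSnnS H2.
- by rewrite -addSnnS H3.
- move=> i hi; rewrite H4 ?leqW // /wr; case: eqP hi => // ->; by rewrite ltnn.
Qed.

Definition inpsym (b : bool) : tsym := Some (inl b).

Lemma inpsym_inj : injective inpsym. Proof. by move=> a b []. Qed.

Lemma inpsym_nb b : inpsym b != None. Proof. by []. Qed.

Definition tm_of (M : omach) : TM :=
  @MkTM (oQ M + bool)%type tsym None inpsym inpsym_inj inpsym_nb
    (inl (o0 M)) (inr true) (inr false) isT
    (fun q y => match q with inl q => od q y | inr b => (inr b, y, MStay) end).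

Lemma tm_of_reach M n a tp h b tp' h' : oreach (M := M) n a tp h b tp' h' ->
  iter n (@step (tm_of M)) (Cfg (M := tm_of M) a tp h) = Cfg (M := tm_of M) b tp' h'.
Proof.
elim=> // {}n q {}tp {}h r g m {}b {}tp' {}h' e _ IH.
rewrite iterSr -IH; congr (iter n _ _).
by rewrite /step /= e; case: m {e IH}.
Qed.

End Compile.

(** [m] sweeps over at most [n + 1 + m] columns take time quadratic in [n + m], which explains the
    exponent [E + E + 2]. *)
Theorem prog_ptime (f : seq bool -> seq bool) (p : prog) C E :
  (forall w, exists s m, [/\ exec p [:: w] s m, m <= C * (size w).+2 ^ E & nth [::] s 1 = f w]) ->
  ptime_computable f.
Proof.
move=> H; pose R := (maxreg p).+2.
pose M := oseq (oseq (oload R) (compile R p)) (oout R).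
pose B := C.+1 * C.+1 * 10.
exists (tm_of M), (B * 3 ^ (E + E + 2)), (E + E + 2) => w.
have [s [m [Hx hm hf]]] := H w; set n := size w in hm *.
have hp : maxreg p < R by rewrite /R.
have fits0 : fits [:: w] n.+1 by case=> [|[|r]] //=; rewrite -/n.
have [hs hfit [t [b [ht Hr]]]] := compile_reach (R := R) Hx hp isT (L := n.+1) isT fits0.
set L := n.+1 + m in hfit ht Hr.
have [||i hi|tp [h [Ho H1 H2 _]]] := @oout_reach R (nth [::] s) L (tpw (word R (nth [::] s) L)) 0 isT.
- exact: hfit.
- by rewrite /tpw size_word add0n ltnn.
- by exists (i == 0); rewrite /tpw size_word add0n hi.
have Hall := tm_of_reach (oseq_reach (oseq_reach (oload_reach R w) Hr) Ho).
rewrite hf in Hall H1 H2.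
set t' := (_ + _) in Hall.
exists t'; split; last first.
  rewrite /run; have -> : init (tm_of M) w = Cfg (M := tm_of M) (inl (o0 M)) (tpi R w) 0 by [].
  by rewrite Hall.
have hsz : size (f w) <= L by rewrite -hf; apply: hfit.
have ht' : t' <= C.+1 * C.+1 * 10 * n.+2 ^ (E + E + 2).
  rewrite /t' -/n; move: hm ht hsz; rewrite /L !expnD.
  have : 0 < n.+2 ^ E by rewrite expn_gt0.
  rewrite expnS expn1; move: (n.+2 ^ E) => x hx hm ht hsz.
  apply: (@leq_trans ((2 * n).+1 + m * (2 * (n.+1 + m) + 1) + (n.+1 + m).+1)); first by lia.
  apply: (@leq_trans ((2 * n).+1 + (C * x) * (2 * (n.+1 + C * x) + 1) + (n.+1 + C * x).+1)).
    by apply: leq_add; [apply: leq_add => //; apply: leq_mul => //; lia | lia].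
  apply: (@leq_trans (C.+1 * C.+1 * 10 * (x * x * n.+2))); last by nia.
  have h1 : x <= x * x by nia.
  have h2 : n.+2 <= x * x * n.+2 by nia.
  have h3 : x * n.+2 <= x * x * n.+2 by nia.
  have h4 : x * x <= x * x * n.+2 by nia.
  have : (2 * n).+1 + C * x * (2 * (n.+1 + C * x) + 1) + (n.+1 + C * x).+1 <=
      3 * n.+2 + 2 * C * (x * n.+2) + 2 * C * C * (x * x) + 2 * C * x by nia.
  move: (x * x * n.+2) h2 h3 h4 h1 => y *; nia.
apply: (leq_trans ht'); rewrite -/B; set e := E + E + 2.
(* For positive [n], [n + 2 <= 3 * n]; for [n = 0] the additive constant takes over. *)
have he : n.+2 ^ e <= 3 ^ e * n ^ e + 3 ^ e.
  rewrite -expnMn; case: (posnP n) => [->|hn].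
    by rewrite (leq_trans _ (leq_addl _ _)) // leq_exp2r // /e addn2.
  by rewrite (leq_trans _ (leq_addr _ _)) // leq_exp2r ?/e ?addn2 //; lia.
by rewrite -(mulnA B) -mulnDr leq_mul2l he orbT.
Qed.

(** * Machine runs as tilings *)

Section Tiles.
Variables (M : TM) (k : nat).

Definition tcell : finType := (tm_sym M * option (tm_st M))%type.
Definition tile : finType := (option tcell * tcell * option tcell)%type.

Definition tleft (x : tile) := x.1.1.
Definition tmid (x : tile) := x.1.2.
Definition tright (x : tile) := x.2.

Definition hstate (q : tm_st M) : bool := (q == tm_qacc M) || (q == tm_qrej M).

(* The state, if any, that the neighbour [x] sends in direction [m]. *)
Definition sends (m : move) (x : option tcell) : option (tm_st M) :=
  if x is Some (s, Some q) then
    if hstate q then None else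
    match m, tm_delta q s with
    | MLeft, (q', _, MLeft) => Some q'
    | MRight, (q', _, MRight) => Some q'
    | _, _ => None
    end
  else None.

(** Without a left neighbour a left move keeps the head in place, matching [0.-1 = 0] in [step]; a
    right move off the last cell of the strip loses the head. *)
Definition loc (l : option tcell) (c : tcell) (r : option tcell) : tcell :=
  match c with
  | (s, Some q) =>
      if hstate q then c else
      let: (q', g, m) := tm_delta q s in
      (g, match m with
          | MStay => Some q'
          | MLeft => if l is None then Some q' else None
          | MRight => None
          end)
  | (s, None) =>
      (s, if sends MRight l is Some q then Some q else sends MLeft r)
  end.

Definition cellof (c : config M) (i : nat) : tcell :=
  (c_tape c i, if i == c_head c then Some (c_st c) else None).

Fixpoint trow (w : seq bool) (W t i : nat) : tcell :=
  match t with
  | 0 => cellof (init M w) i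
  | t'.+1 => loc (if i is i'.+1 then Some (trow w W t' i') else None) (trow w W t' i)
                 (if i.+1 < W then Some (trow w W t' i.+1) else None)
  end.

Lemma loc_step (c : config M) W i : i < W -> c_head c < W ->
  loc (if i is i'.+1 then Some (cellof c i') else None) (cellof c i)
      (if i.+1 < W then Some (cellof c i.+1) else None) = cellof (step c) i.
Proof.
move=> hi hh; rewrite /cellof /step /halted; case: c hh => q tp h /= hh.
case: (eqVneq i h) => [->|ne]; rewrite /loc -/(hstate q).
  case hq: (hstate q) => //=; first by rewrite eqxx.
  case: (tm_delta _ _) => [[q' g] m] /=; rewrite eqxx; congr pair.
  by case: m; case: h hh => [|h] hh //=; case: eqP => //; lia.
have eL : sends MRight (if i is i'.+1 then Some (tp i', if i' == h then Some q else None) else None)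
   = if i == h.+1 then (if hstate q then None else
       if tm_delta q (tp h) is (q', _, MRight) then Some q' else None) else None.
  case: i hi ne => [|i] //= hi ne; rewrite eqSS; case: eqP => [->|//].
  by case: (hstate q) => //; case: (tm_delta _ _) => [[? ?] []].
have eR : sends MLeft (if i.+1 < W then Some (tp i.+1, if i.+1 == h then Some q else None) else None)
   = if i.+1 == h then (if hstate q then None else
       if tm_delta q (tp h) is (q', _, MLeft) then Some q' else None) else None.
  case: ltnP => hiW /=; last by rewrite gtn_eqF // (leq_trans hh).
  case: eqP => [->|//].
  by case: (hstate q) => //; case: (tm_delta _ _) => [[? ?] []].
rewrite eL eR; case hq: (hstate q) => /=; first by rewrite (negbTE ne) !if_same.
case: (tm_delta _ _) => [[q' g] m] /=; rewrite (negbTE ne); congr pair.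
case: m.
- rewrite if_same; case: h ne {hh eL eR} => [|h] /= ne; first by rewrite (negbTE ne).
  by rewrite eqSS.
- by rewrite !if_same (negbTE ne).
- by rewrite !if_same; case: (i == h.+1).
Qed.

Lemma trow_run w W : (forall t, c_head (run M w t) < W) ->
  forall t i, i < W -> trow w W t i = cellof (run M w t) i.
Proof.
move=> hh; elim=> [|t IH] i hi //=.
rewrite -(loc_step hi (hh t)); congr loc; last by case: ltnP => // h; rewrite IH.
  by case: i hi => // i hi; rewrite IH // ltnW.
exact: IH.
Qed.

(* A head that leaves the strip disappears for good. *)
Lemma trow_sound w W t :
  (forall i, i < W -> trow w W t i = cellof (run M w t) i) \/
  (forall i, i < W -> (trow w W t i).2 = None).
Proof.
elim: t => [|t [IH|IH]]; first by left.
  (* The row can still agree with the run while the head stands outside the strip; then no cell of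
     the row carries a state. *)
  case: (ltnP (c_head (run M w t)) W) => hh; last first.
    suff H : forall i, i < W -> (trow w W t i).2 = None.
      right=> i hi /=; rewrite /loc; have := H i hi.
      case: (trow w W t i) => s o /= ->.
      have hs m x : (forall c, x = Some c -> c.2 = None) -> sends m x = None.
        by case: x => [[s' o']|] // /(_ _ erefl) /= ->.
      rewrite !hs // => c; first by case: ltnP => // h [<-]; apply: H.
      by case: (i) hi => // j hj [<-]; apply: H; apply: ltnW.
    by move=> i hi; rewrite IH //= ltn_eqF // (leq_trans hi).
  left=> i hi /=.
  rewrite -(loc_step hi hh); congr loc; last by case: ltnP => // h; rewrite IH.
    by case: i hi => // i hi; rewrite IH // ltnW.
  exact: IH.
right=> i hi /=; rewrite /loc; have := IH i hi.
case: (trow w W t i) => s o /= ->.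
have hs m x : (forall c, x = Some c -> c.2 = None) -> sends m x = None.
  by case: x => [[s' o']|] // /(_ _ erefl) /= ->.
rewrite !hs // => c; first by case: ltnP => // h [<-]; apply: IH.
by case: (i) hi => // j hj [<-]; apply: IH; apply: ltnW.
Qed.

(* Constants: level markers, the blanks right of the input (the flag marks the last one), tiles. *)
Definition cst : finType := ('I_k + (bool + tile))%type.

Inductive ncls := NIn | NCst of cst | NAtom.

(** [e] is the truncated difference of a node and the input length, so that all nodes of the input
    row share the value 0. *)
Definition cls (e : nat) : ncls :=
  if e == 0 then NIn
  else if insub e.-1 is Some i then NCst (enum_val (i : 'I_#|cst|)) else NAtom.

(** This is what lets a program find the class of a node by a number of tests independent of the
    input. *)
Lemma cls_cap e : cls (minn #|cst|.+1 e) = cls e.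
Proof.
rewrite /minn; case: ltnP => // h; rewrite /cls.
have h0 : (e == 0) = false by apply/negbTE; rewrite -lt0n (leq_trans _ h).
have h1 : (e.-1 < #|cst|) = false by apply/negbTE; rewrite -leqNgt; case: e h {h0} => //= e /ltnW.
by rewrite h0 /= !insubF ?ltnn.
Qed.

(** The second alternative is the passage from the end of a row to the beginning of the next one. *)
Definition hrel (x y : tile) : bool :=
  (tleft y == Some (tmid x)) && (tright x == Some (tmid y)) ||
  (tright x == None) && (tleft y == None).

(** The first row consists of the input nodes in order, then blanks: an unflagged blank is followed
    by a blank, the flagged one by a tile that begins a row. Only the node behind the last input bit
    has no bit, so blanks can start nowhere earlier. *)
Definition edgeH (eu ev : ncls) (bit : option bool) (succ : bool) : bool :=
  match eu, ev with
  | NIn, NIn => succ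
  | NIn, NCst (inr (inl _)) => bit == None
  | NCst (inr (inl false)), NCst (inr (inl _)) => true
  | NCst (inr (inl true)), NCst (inr (inr y)) => tleft y == None
  | NCst (inr (inr x)), NCst (inr (inr y)) => hrel x y
  | _, _ => false
  end.

(** The step from the first row to the second produces the initial configuration, so row [t + 1]
    shows time [t]. Border marks are copied downwards. *)
Definition edgeV (eu ev : ncls) (bit : option bool) (isf : bool) : bool :=
  match eu, ev with
  | NIn, NCst (inr (inr y)) =>
      [&& tmid y == (if bit is Some b then tm_inp M b else tm_blank M,
                     if isf then Some (tm_q0 M) else None),
          (tleft y == None) == isf & tright y != None]
  | NCst (inr (inl b)), NCst (inr (inr y)) =>
      [&& tmid y == (tm_blank M, None), tleft y != None & (tright y == None) == b]
  | NCst (inr (inr x)), NCst (inr (inr y)) =>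
      [&& tmid y == loc (tleft x) (tmid x) (tright x),
          (tleft y == None) == (tleft x == None) & (tright y == None) == (tright x == None)]
  | _, _ => false
  end.

Definition level (eu : ncls) : nat :=
  match eu with NCst (inl j) => j | NAtom => 0 | _ => k end.

Definition isFirst (eu : ncls) : bool :=
  if eu is NCst (inr (inr y)) then tleft y == None else false.

Definition isAcc (eu : ncls) : bool :=
  if eu is NCst (inr (inr y)) then (tmid y).2 == Some (tm_qacc M) else false.

Definition isStart (eu : ncls) (isf : bool) : bool := if eu is NIn then isf else false.

(* Labels: 0 joins all nodes (so that every node sequence is a path), 1 and 2 are the horizontal and
   vertical constraints; the others are self-loops used as unary predicates, [6 + j] being "level at
   least j". *)
Definition edgeb (a : nat) (eu ev : ncls) (bit : option bool) (isf same succ : bool) : bool :=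
  match a with
  | 0 => true
  | 1 => edgeH eu ev bit succ
  | 2 => edgeV eu ev bit isf
  | 3 => same && isFirst eu
  | 4 => same && isAcc eu
  | 5 => same && isStart eu isf
  | j.+3.+3 => same && (j <= level eu)
  end.

(* With n = size w, the nodes 0, ..., n form the input row (n is the blank after the input), the next
   #|cst| ones are the constants and all others are atoms. *)
Section Word.
Variable w : seq bool.
Let n := size w.

Definition ncl (u : nat) : ncls := cls (u - n).

Definition edge (a u v : nat) : bool :=
  edgeb a (ncl u) (ncl v) (onth w u) (u == 0) (u == v) (v == u.+1).

Definition cnode (c : cst) : nat := n.+1 + enum_rank c.
Definition anode (i : nat) : nat := n.+1 + #|cst| + i.

Lemma ncl_cnode c : ncl (cnode c) = NCst c.
Proof.
rewrite /ncl /cnode /cls addSn -addnS addKn /=.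
by rewrite [insub _](valK (enum_rank c)) enum_rankK.
Qed.

Lemma ncl_anode i : ncl (anode i) = NAtom.
Proof. by rewrite /ncl /anode /cls !addSn -addnS -addnA addKn /= addnS /= insubF //; lia. Qed.

Lemma ncl_in u : u <= n -> ncl u = NIn.
Proof. by move=> h; rewrite /ncl /cls (_ : u - n = 0) //; lia. Qed.

Lemma ncl_inP u : ncl u = NIn -> u <= n.
Proof.
by rewrite /ncl /cls; case: eqP => [|_]; [lia | case: insubP].
Qed.

(** Rows of width [W] are laid end to end, the last one possibly cut short. The condition on label 3
    keeps the first row from ending before [W]. *)
Definition tiling (m W : nat) (tau : nat -> nat) : Prop :=
  [/\ 0 < W, W < m, edge 5 (tau 0) (tau 0) & forall j, 0 < j < W -> ~~ edge 3 (tau j) (tau j)] /\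
  [/\ forall j, j.+1 < m -> edge 1 (tau j) (tau j.+1),
      forall j, j + W < m -> edge 2 (tau j) (tau (j + W)) &
      exists2 j, j < m & edge 4 (tau j) (tau j)].

(** The first row is forced: input nodes can only follow each other in order, and the flagged blank
    must sit in column [W.-1], since the cell below node 0 begins a row and no earlier one does.
    Vertical edges then force the later rows to be [trow], and [trow_sound] shows that an accepting
    state in [trow] is reached by the run. *)
Lemma tiling_sound m W tau : tiling m W tau -> exists t, c_st (run M w t) = tm_qacc M.
Proof.
move=> [[W0 Wm hS hF] [hH hV [ja hja hA]]].
have st : ncl (tau 0) = NIn /\ tau 0 = 0.
  by move: hS; rewrite /edge /= eqxx /isStart; case: (ncl _) => // /eqP.
have row0 j : j < W -> (j <= n -> tau j = j) /\ (n < j -> exists b, ncl (tau j) = NCst (inr (inl b))).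
  elim: j => [|j IH] hj; first by split=> // _; case: st.
  have {IH}[IH1 IH2] := IH (ltnW hj).
  have hHj := hH j (leq_trans hj (ltnW Wm)); have := hF j.+1 hj.
  rewrite /edge /= eqxx /= => hnF; rewrite /edge /= in hHj.
  case: (ltngtP j n) => hjn.
  - move: hHj; rewrite IH1 ?(ltnW hjn) // ncl_in ?(ltnW hjn) // => hHj.
    split=> [_|]; last by lia.
    case: (ncl _) hHj => [/eqP //|[//|[x|//]]|//] /=.
    by rewrite onthE (nth_map false).
  - have [b eb] := IH2 hjn; move: hHj hnF; rewrite eb {eb}.
    case e: (ncl (tau j.+1)) => [|[j0|[b'|x]]|] /=; try by case: b.
    + by move=> _ _; split; [lia | exists b'].
    + by case: b => // ->.
  - have hle : j <= n by rewrite hjn.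
    move: hHj; rewrite IH1 // ncl_in //= => hHj; split; first by lia.
    move=> _; case e: (ncl (tau j.+1)) hHj => [|[j0|[b|x]]|] //=; try by exists b.
    by move=> /eqP e1; move: (ncl_inP e); rewrite e1 hjn ltnn.
have first_W : isFirst (ncl (tau W)).
  have := hV 0 Wm; rewrite /edge add0n /=; case: st => -> -> /=.
  by case: (ncl _) => // -[//|[//|y]] /and3P[_ /eqP].
have last0 : n < W.-1 /\ ncl (tau W.-1) = NCst (inr (inl true)).
  have hW : W.-1 < W by rewrite prednK.
  have [r1 r2] := row0 _ hW.
  have := hH W.-1; rewrite prednK // => /(_ Wm); rewrite /edge /=.
  case: (leqP W.-1 n) => h.
    rewrite r1 // ncl_in //; case: (ncl (tau W)) first_W => // -[//|[//|y]] //.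
  have [b e] := r2 h; rewrite e; case: b e => // e; case: (ncl (tau W)) first_W => // -[//|[//|y]] //.
have notlast j : j < W.-1 -> ncl (tau j) <> NCst (inr (inl true)).
  move=> hj e; have hj' : 0 < j.+1 < W by lia.
  have hm : j.+1 < m by lia.
  have := hH j hm; have := hF _ hj'; rewrite /edge /= e eqxx /=.
  by case: (ncl (tau j.+1)) => [|[?|[?|y]]|] //= /negP.
have rows t : forall i, i < W -> t.+1 * W + i < m -> exists y,
    [/\ ncl (tau (t.+1 * W + i)) = NCst (inr (inr y)), tmid y = trow w W t i,
        (tleft y == None) = (i == 0) & (tright y == None) = (i == W.-1)].
  elim: t => [|t IH] i hi hm.
    move: hm; rewrite mul1n addnC => hm; have := hV i hm; rewrite /edge /=.
    have [r1 r2] := row0 i hi.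
    have [l1 l2] := last0.
    case: (leqP i n) => h.
      rewrite r1 // ncl_in //; case: (ncl _) => // -[//|[//|y]] /= /and3P[/eqP e1 /eqP e2 e3].
      exists y; split=> //; last by rewrite (negbTE e3); apply/esym/eqP; lia.
      rewrite e1 /cellof /= -/n onthE; case: ltnP => hin; first by rewrite (nth_map false).
      by rewrite nth_default // size_map.
    have [b e] := r2 h; rewrite e /=; case: (ncl _) => // -[//|[//|y]] /= /and3P[/eqP e1 e2 /eqP e3].
    exists y; split=> //.
    - rewrite e1 /cellof /= -/n ltnNge (ltnW h) /=.
      by case: (i) h.
    - by rewrite (negbTE e2); case: (i) h.
    - rewrite e3; case: eqP => [ei|ne]; first by move: e; rewrite ei l2 => -[].
      by case: b {e1 e2 e3} e => // e; case: (@notlast i) => //; lia.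
  have hm' : t.+1 * W + i + W < m by rewrite addnAC -mulSnr.
  have hm1 : t.+1 * W + i < m := leq_ltn_trans (leq_addr _ _) hm'.
  have [x [ex x1 x2 x3]] := IH i hi hm1.
  have := hV _ hm'; rewrite -addnA (addnC i) addnA -mulSnr /edge /= ex.
  case: (ncl _) => // -[//|[//|y]] /= /and3P[/eqP e1 /eqP e2 /eqP e3].
  exists y; split; rewrite ?e2 ?e3 //.
  rewrite e1 /= x1; congr loc.
    case: i hi hm hm' hm1 ex x1 x2 x3 => [|i] hi hm hm' hm1 ex x1 x2 x3.
      by move/eqP: x2.
    have [|x' [ex' x1' x2' x3']] := IH i (ltnW hi); first by rewrite addnS in hm1; apply: ltnW.
    (* The horizontal edge could also be a row break, but only behind column [W.-1], and the left
       neighbour of a cell is never there. *)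
    have := hH (t.+1 * W + i); rewrite -addnS /edge /= ex ex' /= => /(_ hm1) /orP[] /andP[/eqP a b].
      by rewrite a x1'.
    by move: x3'; rewrite a eqxx => /esym/eqP; clear -hi; lia.
  case: ltnP => hiW.
    have hm2 : (t.+1 * W + i).+1 < m by apply: leq_ltn_trans hm'; rewrite -addn1 leq_add2l.
    have [|x' [ex' x1' x2' x3']] := IH i.+1 hiW; first by rewrite addnS.
    have := hH _ hm2; rewrite -addnS /edge /= ex ex' /= => /orP[] /andP[/eqP a /eqP b].
      by rewrite b x1'.
    by move: x3; rewrite a eqxx => /esym/eqP; clear -hiW; lia.
  have ei : i == W.-1 by clear -hi hiW; lia.
  by move: x3; rewrite ei => /eqP.
have jW : W <= ja.
  rewrite leqNgt; apply/negP => h; have [r1 r2] := row0 _ h; move: hA; rewrite /edge /= eqxx /=.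
  case: (leqP ja n) => hn; first by rewrite r1 // ncl_in.
  by have [b ->] := r2 hn.
have eja : ja = (ja %/ W).-1.+1 * W + ja %% W.
  by rewrite prednK ?divn_gt0 // -divn_eq.
have hmod : ja %% W < W by rewrite ltn_mod.
have [|y [ey y1 _ _]] := rows (ja %/ W).-1 _ hmod; first by rewrite -eja.
move: hA; rewrite /edge /= eqxx {1}eja ey /= y1 => /eqP hacc.
exists (ja %/ W).-1; case: (trow_sound w W (ja %/ W).-1) => H; move: hacc; rewrite H //=.
by case: eqP => // _ [].
Qed.

Definition ttile (W t i : nat) : tile :=
  (if i is i'.+1 then Some (trow w W t i') else None, trow w W t i,
   if i.+1 < W then Some (trow w W t i.+1) else None).

Definition ttau (W j : nat) : nat :=
  if j < W then (if j <= n then j else cnode (inr (inl (j == W.-1))))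
  else cnode (inr (inr (ttile W (j %/ W).-1 (j %% W)))).

Lemma ttau_le W j : ttau W j <= n + #|cst|.
Proof.
have h c : cnode c <= n + #|cst| by rewrite /cnode addSn -addnS leq_add2l ltn_ord.
by rewrite /ttau; case: ifP => // _; case: (leqP j n) => [hj|//]; rewrite (leq_trans hj) // leq_addr.
Qed.

Lemma ttau_cell W j : k <= level (ncl (ttau W j)).
Proof.
rewrite /ttau; case: ifP => _; last by rewrite ncl_cnode.
by case: (leqP j n) => h; [rewrite ncl_in | rewrite ncl_cnode].
Qed.

(** There are [t.+2] rows, for the input and for the times [0] to [t]; [n.+2 <= W] leaves room for
    at least one blank node, which carries the flag. *)
Lemma tiling_complete W t : (forall t, c_head (run M w t) < W) -> n.+2 <= W ->
  c_st (run M w t) = tm_qacc M -> tiling (t.+2 * W) W (ttau W).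
Proof.
move=> hh hW hacc; have W0 : 0 < W by lia.
have ncl_row0 j : j < W -> ncl (ttau W j) = if j <= n then NIn else NCst (inr (inl (j == W.-1))).
  by rewrite /ttau => ->; case: (leqP j n) => h; [rewrite ncl_in | rewrite ncl_cnode].
have ncl_rows j : W <= j -> ncl (ttau W j) = NCst (inr (inr (ttile W (j %/ W).-1 (j %% W)))).
  by rewrite /ttau ltnNge => -> /=; rewrite ncl_cnode.
split; first split=> //.
- by rewrite !mulSn; lia.
- by rewrite /ttau W0 leq0n /edge ncl_in.
- by move=> j /andP[_ hj]; rewrite /edge /= eqxx ncl_row0 //; case: ifP.
split.
- move=> j hj; rewrite /edge /=; case: (ltnP j.+1 W) => hjW.
    rewrite !ncl_row0 ?(ltnW hjW) //; case: (leqP j.+1 n) => h1.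
      by rewrite (ltnW h1) /= /ttau hjW (ltnW hjW) h1 (ltnW h1).
    case: (leqP j n) => h2; last by rewrite /= (_ : j == W.-1 = false) //; apply/eqP; lia.
    by rewrite /= /ttau (ltnW hjW) h2 onthE nth_default // size_map.
  case: (ltnP j W) => hj2.
    have ej : j.+1 = W by lia.
    rewrite ncl_row0 // ncl_rows // ifF /=; last by apply/negbTE; lia.
    by rewrite -ej eqxx modnn.
  rewrite !ncl_rows // /= /hrel /ttile.
  have hd : j.+1 = (j %/ W) * W + (j %% W).+1 by rewrite addnS -divn_eq.
  have hmod : j %% W < W by rewrite ltn_mod.
  case: (ltnP (j %% W).+1 W) => h.
    have -> : j.+1 %/ W = j %/ W by rewrite hd divnMDl // (divn_small h) addn0.
    have -> : j.+1 %% W = (j %% W).+1 by rewrite hd modnMDl (modn_small h).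
    by rewrite /tleft /tmid /tright /= !eqxx.
  have e : (j %% W).+1 = W by lia.
  have -> : j.+1 %% W = 0 by rewrite hd modnMDl e modnn.
  by rewrite /tleft /tright /= ?orbT ?andbT; case: eqP => // ->.
- move=> j hj; rewrite /edge /= [X in edgeV _ X]ncl_rows ?leq_addl //.
  have -> : (j + W) %% W = j %% W by rewrite modnDr.
  have -> : ((j + W) %/ W).-1 = j %/ W by rewrite divnDr // divnn W0 addn1.
  case: (ltnP j W) => hjW.
    rewrite ncl_row0 // divn_small // modn_small //.
    case: (leqP j n) => h.
      have -> : ttau W j = j by rewrite /ttau hjW h.
      rewrite /edgeV /ttile /tmid /tleft /tright /= /cellof /= onthE -/n.
      have -> : j.+1 < W by lia.
      apply/and3P; split=> //; last by case: (j).
      apply/eqP; congr pair; case: ltnP => hjn; first by rewrite (nth_map false).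
      by rewrite nth_default // size_map.
    rewrite /edgeV /ttile /tmid /tleft /tright /= /cellof /= -/n ltnNge (ltnW h) /=.
    case: (j) h hjW => // j' h hjW; rewrite eqxx /=.
    have -> : (j'.+1 == W.-1) = ~~ (j'.+2 < W) by lia.
    by case: ltnP.
  rewrite ncl_rows // /edgeV /ttile /tmid /tleft /tright /=.
  have hd : j %/ W = (j %/ W).-1.+1 by rewrite prednK // divn_gt0.
  rewrite {1}hd /= eqxx /=; apply/andP; split; first by case: (j %% W).
  by case: ltnP.
- pose h := c_head (run M w t); have hhW : h < W by apply: hh.
  exists (t.+1 * W + h); first by rewrite (mulSn t.+1) addnC ltn_add2r.
  rewrite /edge /= eqxx ncl_rows; last by rewrite mulSn; lia.
  rewrite divnMDl // divn_small // addn0 modnMDl modn_small //=.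
  by rewrite /ttile /tmid /= (trow_run hh) // /cellof /= eqxx hacc.
Qed.

End Word.
End Tiles.

(** * The formula and its semantics *)

Definition nlab (k : nat) : nat := (6 + k).+1.

Section Formula.
Variable k : nat.
Notation wlk := (wl (nlab k)).

Definition wand (f g : wlk) : wlk := WNeg (WOr (WNeg f) (WNeg g)).
Definition wimp (f g : wlk) : wlk := WOr (WNeg f) g.
Definition wex (i : nat) (f : wlk) : wlk := WExPos 0 i f.
Definition wall (i : nat) (f : wlk) : wlk := WNeg (wex i (WNeg f)).
Definition wlt (i j : nat) : wlk := WLt (nlab k) 0 i j.

(* Nodes are adjacent iff some path, assigned to path variable 1, crosses the edge. *)
Definition wadj (a x y : nat) : wlk :=
  WExPath 1 (WExPos 1 0 (WExPos 1 1
    (wand (WE (inord a : 'I_(nlab k)) 1 0 1)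
       (wand (WSim (nlab k) 1 0 0 x) (WSim (nlab k) 1 1 0 y))))).

Definition wlev (j x : nat) : wlk := wadj (6 + j) x x.

(* In all formulas below, [d] is the first position variable that is not in use. *)
Definition wblk (j d u x : nat) : wlk :=
  wand (wlt u x) (wand (wlev j u)
    (WNeg (wex d (wand (WNeg (wlt d u)) (wand (wlt d x) (wlev j.+1 d)))))).

(* The position of a node of level [j + 1] stands for the set of the positions of level [j] between it
   and the previous node of level at least [j + 1]; [wR j] is equality of hereditarily finite sets. *)
Fixpoint wR (j d x y : nat) : wlk :=
  match j with
  | 0 => WSim (nlab k) 0 x 0 y
  | j'.+1 =>
    wand (wall d (wimp (wblk j' d.+1 d x) (wex d.+1 (wand (wblk j' d.+2 d.+1 y) (wR j' d.+2 d d.+1)))))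
         (wall d (wimp (wblk j' d.+1 d y) (wex d.+1 (wand (wblk j' d.+2 d.+1 x) (wR j' d.+2 d.+1 d)))))
  end.

Definition wnxt (d x y : nat) : wlk :=
  wand (wlev k x) (wand (wlev k y) (wand (wlt x y)
    (WNeg (wex d (wand (wlt x d) (wand (wlt d y) (wlev k d))))))).

Definition wN (d x y : nat) : wlk :=
  wand (wlev k x) (wand (wlev k y) (wand (wlt x y) (wand (wR k d x y)
    (WNeg (wex d (wand (wlt x d) (wand (wlt d y) (wand (wlev k d) (wR k d.+1 x d))))))))).

(** The clauses of [tiling], with [wN] in the place of a shift by [W]; the fourth conjunct is the
    one that makes this shift uniform along the path. *)
Definition wbody : wlk :=
   wand (wex 0 (wex 1 (wand (wadj 5 0 0) (wand (wN 2 0 1)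
           (wand (WNeg (wex 2 (wand (wlt 2 0) (wlev k 2))))
                 (WNeg (wex 2 (wand (wlt 0 2) (wand (wlt 2 1) (wand (wlev k 2) (wadj 3 2 2)))))))))))
   (wand (wall 0 (wall 1 (wimp (wnxt 2 0 1) (wadj 1 0 1))))
   (wand (wall 0 (wall 1 (wimp (wN 2 0 1) (wadj 2 0 1))))
   (wand (wall 0 (wall 1 (wall 2 (wall 3
           (wimp (wN 4 0 1) (wimp (wnxt 4 0 2) (wimp (wnxt 4 1 3) (wN 4 2 3))))))))
         (wex 0 (wand (wlev k 0) (wadj 4 0 0)))))).

Definition wphi : wlk := WExPath 0 wbody.

Lemma closed_wadj B a x y : (0, x) \in B -> (0, y) \in B -> closed_wl B (wadj a x y).
Proof. by move=> hx hy; rewrite /= !inE ?hx ?hy /= ?orbT ?hx ?hy. Qed.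

Lemma closed_wblk B j d u x : (0, u) \in B -> (0, x) \in B -> closed_wl B (wblk j d u x).
Proof.
move=> hu hx; rewrite /wblk /wlev; cbn [closed_wl wand wex wlt].
by rewrite !closed_wadj ?inE ?hu ?hx ?eqxx ?orbT.
Qed.

Lemma closed_wR j : forall B d x y, (0, x) \in B -> (0, y) \in B -> closed_wl B (wR j d x y).
Proof.
elim: j => [|j IH] B d x y hx hy; first by rewrite /= hx.
cbn [closed_wl wR wand wall wex wimp].
by rewrite !closed_wblk ?IH ?inE ?hx ?hy ?eqxx ?orbT.
Qed.

Lemma closed_wnxt B d x y : (0, x) \in B -> (0, y) \in B -> closed_wl B (wnxt d x y).
Proof.
move=> hx hy; rewrite /wnxt /wlev; cbn [closed_wl wand wex wlt].
by rewrite !closed_wadj ?inE ?hx ?hy ?eqxx ?orbT.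
Qed.

Lemma closed_wN B d x y : (0, x) \in B -> (0, y) \in B -> closed_wl B (wN d x y).
Proof.
move=> hx hy; rewrite /wN /wlev; cbn [closed_wl wand wex wlt].
by rewrite !closed_wadj ?closed_wR ?inE ?hx ?hy ?eqxx ?orbT.
Qed.

Lemma boolean_wphi : boolean_wl wphi.
Proof.
rewrite /boolean_wl /wphi /wbody /wlev; cbn [closed_wl wand wex wlt wall wimp].
by rewrite !closed_wadj ?closed_wN ?closed_wnxt.
Qed.

End Formula.

(* The suffix S marks the meaning of the formula with prefix w, on a word with nodes [nd 1], ...,
   [nd len]. *)
Section Semantics.
Variables (k : nat) (E : nat -> nat -> nat -> bool) (len : nat) (nd : nat -> nat).

Definition levS (j x : nat) : bool := E (6 + j) (nd x) (nd x).

Definition blkS (j u x : nat) : Prop :=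
  [/\ 0 < u, u < x, levS j u & forall z, u <= z -> z < x -> ~~ levS j.+1 z].

Fixpoint RS (j x y : nat) : Prop :=
  match j with
  | 0 => nd x = nd y
  | j'.+1 => (forall u, blkS j' u x -> exists2 v, blkS j' v y & RS j' u v) /\
             (forall u, blkS j' u y -> exists2 v, blkS j' v x & RS j' v u)
  end.

Definition inrange (x : nat) : bool := 0 < x <= len.

Definition nxtS (x y : nat) : Prop :=
  [/\ levS k x, levS k y, x < y & forall z, x < z -> z < y -> ~~ levS k z].

Definition NS (x y : nat) : Prop :=
  [/\ levS k x, levS k y, x < y, RS k x y & forall z, x < z -> z < y -> levS k z -> ~ RS k x z].

Definition PhiS : Prop :=
  (exists x y, [/\ inrange x && inrange y, E 5 (nd x) (nd x), NS x y,
     (forall z, 0 < z -> z < x -> ~~ levS k z) &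
     (forall z, x < z -> z < y -> levS k z -> ~~ E 3 (nd z) (nd z))]) /\
  (forall x y, inrange x -> inrange y -> nxtS x y -> E 1 (nd x) (nd y)) /\
  (forall x y, inrange x -> inrange y -> NS x y -> E 2 (nd x) (nd y)) /\
  (forall x y x' y', inrange x -> inrange y -> inrange x' -> inrange y' ->
     NS x y -> nxtS x x' -> nxtS y y' -> NS x' y') /\
  (exists x, [/\ inrange x, levS k x & E 4 (nd x) (nd x)]).

End Semantics.

(** * Satisfaction of the formula in a graph database *)

Section Sat.
Variables (k : nat) (G : dgraph (nlab k)) (E : nat -> nat -> nat -> bool).
Hypothesis dkI : is_database G.
Hypothesis dEE : forall a (u v : 'I_(dn G)), a < nlab k -> ((u, inord a, v) \in dE G) = E a u v.

Notation satk := (@sat (nlab k) G).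
Implicit Types (mu : nat -> nat -> nat).

Lemma node_at_cons (v w : 'I_(dn G)) b st i : i <= size st ->
  node_at (G := G) (v, (b, w) :: st) i.+2 = node_at (G := G) (w, st) i.+1.
Proof.
case: i => [|i] hi //; rewrite /node_at /= !subSS subn0.
by apply: set_nth_default; rewrite size_map.
Qed.

Lemma label_at_cons (v w : 'I_(dn G)) b st i :
  label_at (G := G) (v, (b, w) :: st) i.+2 = label_at (G := G) (w, st) i.+1.
Proof. by rewrite /label_at /plen /= !subn1. Qed.

Lemma valid_edge st : forall (v : 'I_(dn G)) i (a : 'I_(nlab k)), valid_steps v st ->
  label_at (G := G) (v, st) i = Some a ->
  (node_at (G := G) (v, st) i, a, node_at (G := G) (v, st) i.+1) \in dE G.
Proof.
elim: st => [|[b w] st IH] v i a /=; first by rewrite /label_at /plen /=; case: i => [|[]].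
move=> /andP[hb hv]; case: i => [|[|i]] //; first by rewrite /label_at /= => -[<-].
rewrite label_at_cons => h.
have hi : i < size st by move: h; rewrite /label_at /plen /=; case: ifP.
by rewrite !node_at_cons ?(ltnW hi) //; apply: IH.
Qed.

Section Fixed.
Variables (rho : nat -> option (gpath G)) (p : gpath G).
Hypothesis rho0 : rho 0 = Some p.
Let nd (i : nat) : nat := node_at p i.
Let len := plen p.

Lemma sat_wneg mu f : satk rho mu (WNeg f) <-> ~ satk rho mu f.
Proof. by []. Qed.

(** Conjunction is a defined connective, so reading it back needs classical logic; the same holds
    for implication and universal quantification. *)
Lemma sat_wand mu f g : satk rho mu (wand f g) <-> satk rho mu f /\ satk rho mu g.
Proof.
split=> [H|[Hf Hg] [|] //]; split; apply: NNPP => h; apply: H; [by left | by right].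
Qed.

Lemma sat_wimp mu f g : satk rho mu (wimp f g) <-> (satk rho mu f -> satk rho mu g).
Proof.
split=> [[|]|H] //; case: (classic (satk rho mu f)) => h; [by right; apply: H | by left].
Qed.

Lemma sat_wex mu i f : satk rho mu (wex i f) <->
  exists2 x, inrange len x & satk rho (upd_pos mu 0 i x) f.
Proof. by rewrite /= rho0; split=> [[x []]|[x h1 h2]]; exists x. Qed.

Lemma sat_wall mu i f : satk rho mu (wall i f) <->
  forall x, inrange len x -> satk rho (upd_pos mu 0 i x) f.
Proof.
rewrite sat_wneg sat_wex; split=> [H x hx|H [x hx]]; last by apply; apply: H.
by apply: NNPP => h; apply: H; exists x.
Qed.

Lemma sat_wlt mu i j : inrange len (mu 0 i) -> inrange len (mu 0 j) ->
  satk rho mu (wlt k i j) <-> mu 0 i < mu 0 j.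
Proof.
move=> hi hj; split=> [[q []] _ [_ []]//|h].
by exists p; split=> //; split=> //; split.
Qed.

(** Injectivity of the data values identifies the ends of the crossed edge with the two given nodes;
    conversely, the path made of that single edge is a witness. *)
Lemma sat_wadj mu a x y : a < nlab k -> inrange len (mu 0 x) -> inrange len (mu 0 y) ->
  satk rho mu (wadj k a x y) <-> E a (nd (mu 0 x)) (nd (mu 0 y)).
Proof.
move=> ha hx hy; rewrite -dEE //; split.
  move=> [q [vq]] /=; rewrite {1}/upd_path /= => -[i [hi]].
  rewrite {1}/upd_path /= => -[j [hj H]].
  have {H} : [/\ j = i.+1, label_at q i = Some (inord a),
      node_at q i = node_at p (mu 0 x) & node_at q j = node_at p (mu 0 y)].
    split.
    + apply: NNPP => ne; apply: H; left => -[q' [[<-] [_ [_ [e _]]]]]; exact: ne e.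
    + apply: NNPP => ne; apply: H; left => -[q' [[<-] [_ [_ [_ e]]]]]; exact: ne e.
    + apply: NNPP => ne; apply: H; right => H; apply: H; left => -[q1 [q2 [[<-] []]]].
      rewrite /upd_path /= rho0 => -[<-] [_ [_ e]]; apply: ne; exact: dkI e.
    + apply: NNPP => ne; apply: H; right => H; apply: H; right => -[q1 [q2 [[<-] []]]].
      rewrite /upd_path /= rho0 => -[<-] [_ [_ e]]; apply: ne; exact: dkI e.
  move=> /= [ej el <- <-]; rewrite ej; case: q vq el {hi hj} => v st vq el.
  exact: valid_edge.
move=> hE; exists (node_at p (mu 0 x), [:: (inord a, node_at p (mu 0 y))]).
split; first by rewrite /valid_path /= hE.
rewrite /= /upd_path /=; exists 1; split=> //; exists 2; split=> //.
case=> H; apply: H.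
  by eexists; split; first reflexivity.
case=> H; apply: H; eexists; exists p; (split; first reflexivity); by [].
Qed.

Lemma upd_pos0 mu i x j : upd_pos mu 0 i x 0 j = if j == i then x else mu 0 j.
Proof. by []. Qed.

Lemma inrangeW x z : 0 < z -> z <= x -> inrange len x -> inrange len z.
Proof. by rewrite /inrange; lia. Qed.

Lemma sat_wlev mu j x : j <= k -> inrange len (mu 0 x) ->
  satk rho mu (wlev k j x) <-> levS E nd j (mu 0 x).
Proof. by move=> hj hx; apply: sat_wadj => //; rewrite /nlab; lia. Qed.

Lemma sat_wblk mu j d u x : j < k -> u < d -> x < d ->
  inrange len (mu 0 u) -> inrange len (mu 0 x) ->
  satk rho mu (wblk k j d u x) <-> blkS E nd j (mu 0 u) (mu 0 x).
Proof.
move=> hj hud hxd hu hx.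
have eu z : upd_pos mu 0 d z 0 u = mu 0 u by rewrite upd_pos0 ltn_eqF.
have ex z : upd_pos mu 0 d z 0 x = mu 0 x by rewrite upd_pos0 ltn_eqF.
have ed z : upd_pos mu 0 d z 0 d = z by rewrite upd_pos0 eqxx.
rewrite /wblk !sat_wand sat_wneg sat_wex sat_wlt // sat_wlev ?(ltnW hj) //.
split=> [[h1 [h2 h3]]|[h0 h1 h2 h3]].
  split=> // [|z hz1 hz2]; first by case/andP: hu.
  apply/negP => hz; apply: h3.
  have hzr : inrange len z by apply: inrangeW hx; [case/andP: hu; lia | exact: ltnW].
  exists z => //; rewrite !sat_wand.
  split; first by rewrite sat_wneg sat_wlt ?ed ?eu // ltnNge hz1.
  by rewrite sat_wlt ?ed ?ex // sat_wlev ?ed.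
split=> //; split=> // -[z hz]; rewrite !sat_wand sat_wneg !sat_wlt ?ed ?ex ?eu // sat_wlev ?ed //.
case=> [hzu [hzx]]; apply/negP; apply: h3 => //.
by rewrite leqNgt; apply/negP.
Qed.

Lemma sat_wR j : j <= k -> forall mu d x y, x < d -> y < d ->
  inrange len (mu 0 x) -> inrange len (mu 0 y) ->
  satk rho mu (wR k j d x y) <-> RS E nd j (mu 0 x) (mu 0 y).
Proof.
elim: j => [|j IH] hj mu d x y hxd hyd hx hy.
  split=> [|h].
    move=> [q1 [q2]]; rewrite rho0 => -[[<-] [[<-] [_ [_ /dkI e]]]].
    by rewrite /= /nd e.
  exists p, p; split=> //; split=> //; split=> //; split=> //; congr dk; exact: val_inj.
have {}IH := IH (ltnW hj).
(* One inclusion of the extensionality test. [F] and [P] are kept abstract because the second half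
   swaps the arguments of the recursive call. *)
have side mu' x' y' : x' < d -> y' < d -> inrange len (mu' 0 x') -> inrange len (mu' 0 y') ->
  forall F : nat -> nat -> wl (nlab k), forall P : nat -> nat -> Prop,
  (forall u v, inrange len u -> inrange len v ->
     satk rho (upd_pos (upd_pos mu' 0 d u) 0 d.+1 v) (F d d.+1) <-> P u v) ->
  satk rho mu' (wall d (wimp (wblk k j d.+1 d x')
      (wex d.+1 (wand (wblk k j d.+2 d.+1 y') (F d d.+1))))) <->
  (forall u, blkS E nd j u (mu' 0 x') -> exists2 v, blkS E nd j v (mu' 0 y') & P u v).
  move=> hx' hy' hmx hmy F P HF.
  have e1 u : upd_pos mu' 0 d u 0 d = u by rewrite upd_pos0 eqxx.
  have e2 u : upd_pos mu' 0 d u 0 x' = mu' 0 x' by rewrite upd_pos0 ltn_eqF.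
  have e3 u v : upd_pos (upd_pos mu' 0 d u) 0 d.+1 v 0 d.+1 = v by rewrite upd_pos0 eqxx.
  have e4 u v : upd_pos (upd_pos mu' 0 d u) 0 d.+1 v 0 y' = mu' 0 y'.
    by rewrite !upd_pos0 !ltn_eqF // ltnW.
  have hx2 : x' < d.+1 by apply: ltnW.
  have hy2 : y' < d.+2 by apply/ltnW/ltnW.
  rewrite sat_wall; split=> H u.
    move=> hb; have hu : inrange len u by case: hb => h1 /ltnW h2 _ _; exact: inrangeW hmx.
    have := H u hu; rewrite sat_wimp sat_wblk ?e1 ?e2 // => /(_ hb) /sat_wex[v hv].
    by rewrite sat_wand sat_wblk ?e3 ?e4 // HF // => -[hv1 hv2]; exists v.
  move=> hu; rewrite sat_wimp sat_wblk ?e1 ?e2 // => /H[v hv hP]; apply/sat_wex.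
  have hvr : inrange len v by case: hv => h1 /ltnW h2 _ _; exact: inrangeW hmy.
  by exists v => //; rewrite sat_wand sat_wblk ?e3 ?e4 // HF.
have eu m u v : upd_pos (upd_pos m 0 d u) 0 d.+1 v 0 d = u.
  by rewrite !upd_pos0 eqxx ltn_eqF.
have ev m u v : upd_pos (upd_pos m 0 d u) 0 d.+1 v 0 d.+1 = v by rewrite upd_pos0 eqxx.
rewrite [wR _ _ _ _ _]/=  sat_wand.
rewrite (@side mu x y hxd hyd hx hy (fun u v => wR k j d.+2 u v) (RS E nd j)); last first.
  by move=> u v hu hv; rewrite IH ?eu ?ev //.
rewrite (@side mu y x hyd hxd hy hx (fun u v => wR k j d.+2 v u) (fun u v => RS E nd j v u)) //.
by move=> u v hu hv; rewrite IH ?eu ?ev //.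
Qed.

Lemma sat_wnxt mu d x y : x < d -> y < d -> inrange len (mu 0 x) -> inrange len (mu 0 y) ->
  satk rho mu (wnxt k d x y) <-> nxtS k E nd (mu 0 x) (mu 0 y).
Proof.
move=> hxd hyd hx hy.
have ey z : upd_pos mu 0 d z 0 y = mu 0 y by rewrite upd_pos0 ltn_eqF.
have ex z : upd_pos mu 0 d z 0 x = mu 0 x by rewrite upd_pos0 ltn_eqF.
have ed z : upd_pos mu 0 d z 0 d = z by rewrite upd_pos0 eqxx.
rewrite /wnxt !sat_wand sat_wneg sat_wex sat_wlt // !sat_wlev //; split=> [[h1 [h2 [h3 h4]]]|[h1 h2 h3 h4]].
  split=> // z hz1 hz2; apply/negP => hz; apply: h4.
  have hzr : inrange len z by apply: inrangeW hy; lia.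
  by exists z => //; rewrite !sat_wand !sat_wlt ?ed ?ex ?ey // sat_wlev ?ed.
split=> //; split=> //; split=> // -[z hz].
rewrite !sat_wand !sat_wlt ?ed ?ex ?ey // sat_wlev ?ed // => -[hz1 [hz2]].
by apply/negP/h4.
Qed.

Lemma sat_wN mu d x y : x < d -> y < d -> inrange len (mu 0 x) -> inrange len (mu 0 y) ->
  satk rho mu (wN k d x y) <-> NS k E nd (mu 0 x) (mu 0 y).
Proof.
move=> hxd hyd hx hy.
have ey z : upd_pos mu 0 d z 0 y = mu 0 y by rewrite upd_pos0 ltn_eqF.
have ex z : upd_pos mu 0 d z 0 x = mu 0 x by rewrite upd_pos0 ltn_eqF.
have ed z : upd_pos mu 0 d z 0 d = z by rewrite upd_pos0 eqxx.
have hx2 : x < d.+1 by apply: ltnW.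
rewrite /wN !sat_wand sat_wneg sat_wex sat_wlt // !sat_wlev // sat_wR //.
split=> [[h1 [h2 [h3 [h5 h4]]]]|[h1 h2 h3 h5 h4]].
  split=> // z hz1 hz2 hc hR; apply: h4.
  have hzr : inrange len z by apply: inrangeW hy; lia.
  by exists z => //; rewrite !sat_wand !sat_wlt ?ed ?ex ?ey // sat_wlev ?ed // sat_wR ?ed ?ex.
split=> //; split=> //; split=> //; split=> // -[z hz].
rewrite !sat_wand !sat_wlt ?ed ?ex ?ey // sat_wlev ?ed // sat_wR ?ed ?ex // => -[hz1 [hz2 [hc]]].
exact: h4.
Qed.

Lemma sat_wbody mu : satk rho mu (wbody k) <-> PhiS k E len nd.
Proof.
have lab j : j <= 6 -> j < nlab k by rewrite /nlab; lia.
rewrite /wbody /PhiS !sat_wand.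
set A := satk rho mu _; set B := satk rho mu _; set C := satk rho mu _.
set D := satk rho mu _; set F := satk rho mu _.
have -> : B <-> (forall x y, inrange len x -> inrange len y -> nxtS k E nd x y -> E 1 (nd x) (nd y)).
  rewrite /B sat_wall; split=> H x; last first.
    by move=> hx; rewrite sat_wall => y hy; rewrite sat_wimp sat_wnxt // sat_wadj ?lab //; apply: H.
  by move=> y hx; have := H x hx; rewrite sat_wall => {}H hy; have := H y hy; rewrite sat_wimp sat_wnxt // sat_wadj ?lab.
have -> : C <-> (forall x y, inrange len x -> inrange len y -> NS k E nd x y -> E 2 (nd x) (nd y)).
  rewrite /C sat_wall; split=> H x; last first.
    by move=> hx; rewrite sat_wall => y hy; rewrite sat_wimp sat_wN // sat_wadj ?lab //; apply: H.
  by move=> y hx; have := H x hx; rewrite sat_wall => {}H hy; have := H y hy; rewrite sat_wimp sat_wN // sat_wadj ?lab.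
have -> : F <-> (exists x, [/\ inrange len x, levS E nd k x & E 4 (nd x) (nd x)]).
  rewrite /F sat_wex; split=> [[x hx]|[x [hx h1 h2]]]; last first.
    by exists x => //; rewrite sat_wand sat_wlev // sat_wadj ?lab.
  by rewrite sat_wand sat_wlev // sat_wadj ?lab // => -[h1 h2]; exists x.
have -> : D <-> (forall x y x' y', inrange len x -> inrange len y -> inrange len x' -> inrange len y' ->
     NS k E nd x y -> nxtS k E nd x x' -> nxtS k E nd y y' -> NS k E nd x' y').
  rewrite /D sat_wall; split=> H x.
    move=> y x' y' hx hy hx' hy'; have := H x hx; rewrite sat_wall => /(_ y hy).
    rewrite sat_wall => /(_ x' hx'); rewrite sat_wall => /(_ y' hy').
    by rewrite !sat_wimp !sat_wN // !sat_wnxt.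
  move=> hx; rewrite sat_wall => y hy; rewrite sat_wall => x' hx'; rewrite sat_wall => y' hy'.
  by rewrite !sat_wimp !sat_wN // !sat_wnxt //; apply: H.
suff -> : A <-> exists x y, [/\ inrange len x && inrange len y, E 5 (nd x) (nd x), NS k E nd x y,
     (forall z, 0 < z -> z < x -> ~~ levS E nd k z) &
     (forall z, x < z -> z < y -> levS E nd k z -> ~~ E 3 (nd z) (nd z))] by [].
rewrite /A sat_wex.
split=> [[x hx /sat_wex[y hy]]|[x [y [/andP[hx hy] h1 h2 h3 h4]]]].
  rewrite sat_wand sat_wand sat_wN // sat_wand sat_wadj ?lab // !sat_wneg !sat_wex => -[h1 [h2 [h3 h4]]].
  exists x, y; rewrite hx hy; split=> // z hz1 hz2.
    have hz : inrange len z by apply: inrangeW hx => //; apply: ltnW.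
    apply/negP => hl; apply: h3; exists z => //.
    by rewrite sat_wand sat_wlt // sat_wlev.
  have hz : inrange len z by apply: inrangeW hy; lia.
  move=> hl; apply/negP => hF; apply: h4; exists z => //.
  by rewrite !sat_wand !sat_wlt // sat_wlev // sat_wadj ?lab.
exists x => //; apply/sat_wex; exists y => //.
rewrite sat_wand sat_wand sat_wN // sat_wand sat_wadj ?lab // !sat_wneg !sat_wex.
split=> //; split=> //; split=> -[z hz]; rewrite !sat_wand !sat_wlt // sat_wlev //.
  by case=> hz1; apply/negP/h3 => //; case/andP: hz.
by rewrite sat_wadj ?lab // => -[hz1 [hz2 [hl]]]; apply/negP/h4.
Qed.

End Fixed.

Lemma models_wphi : models G (wphi k) <->
  exists p : gpath G, valid_path p /\ PhiS k E (plen p) (fun i => node_at p i).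
Proof.
have W p := @sat_wbody (upd_path (fun _ => None) 0 p) p erefl (fun _ _ => 1).
rewrite /models /wphi; cbn [sat].
by split=> -[p [vp H]]; exists p; (split; first exact: vp); [apply: (proj1 (W p)) | apply: (proj2 (W p))]; exact H.
Qed.

End Sat.

(** * Tilings and paths *)

Lemma sorted_ltn_gap (e : seq nat) j z : sorted ltn e -> j.+1 < size e ->
  nth 0 e j < z -> z < nth 0 e j.+1 -> z \notin e.
Proof.
move=> es hj hz1 hz2; apply/negP => ze.
have mono i l : i < l -> l < size e -> nth 0 e i < nth 0 e l.
  by move=> hil hl; apply: (sorted_ltn_nth ltn_trans 0 es) => //; rewrite inE // (ltn_trans hil).
have hi : index z e < size e by rewrite index_mem.
have ei := nth_index 0 ze; move: (index z e) hi ei => i hi ei.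
case: (leqP i j) => hij; last case: (leqP j.+2 i) => hij2.
- move: hij; rewrite leq_eqVlt => /orP[/eqP eij|hij]; first by rewrite -ei eij ltnn in hz1.
  by have := mono _ _ hij (ltnW hj); rewrite ei => /(ltn_trans hz1); rewrite ltnn.
- by have := mono _ _ hij2 hi; rewrite ei => /(ltn_trans hz2); rewrite ltnn.
- have eij : i = j.+1 by apply/eqP; rewrite eqn_leq -ltnS hij2.
  by rewrite -ei eij ltnn in hz2.
Qed.

(** [tau] lists the nodes of level [k] along the path, and [W] is the index of the cell paired with
    the first one. Stability of [NS] under successors then pairs every cell with the one [W] further
    on, whatever [RS] means on this path. *)
Lemma PhiS_tiling (M : TM) k w len nd : PhiS k (edge M k w) len nd ->
  exists m W tau, tiling M k w m W tau.
Proof.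
set E := edge M k w.
move=> [[x [y [/andP[hx hy] hS hN hb hF]]] [hH [hV [hC [xa [hxa la hA]]]]]].
pose e := [seq x <- iota 1 len | levS E nd k x].
have mem_e z : (z \in e) = inrange len z && levS E nd k z.
  by rewrite mem_filter mem_iota add1n ltnS andbC.
have es : sorted ltn e by apply: sorted_filter (iota_ltn_sorted _ _); apply: ltn_trans.
pose m := size e; pose p j := nth 0 e j.
have mono i j : i < j -> j < m -> p i < p j.
  by move=> hij hj; apply: (sorted_ltn_nth ltn_trans 0 es) => //; rewrite inE // (ltn_trans hij).
have pP j : j < m -> inrange len (p j) /\ levS E nd k (p j).
  by move=> hj; apply/andP; rewrite -mem_e mem_nth.
have idx z : inrange len z -> levS E nd k z -> exists2 i, i < m & p i = z.
  by move=> h1 h2; exists (index z e); rewrite /p ?nth_index // ?index_mem mem_e h1.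
have nxt_e j : j.+1 < m -> nxtS k E nd (p j) (p j.+1).
  move=> hj; have [r1 l1] := pP _ (ltnW hj); have [r2 l2] := pP _ hj.
  split=> //; first exact: mono.
  move=> z hz1 hz2; apply/negP => lz.
  have hz : inrange len z by case/andP: r1 r2 => h1 _ /andP[_ h2]; rewrite /inrange; clear -hz1 hz2 h1 h2; lia.
  by have := sorted_ltn_gap es hj hz1 hz2; rewrite mem_e hz lz.
have [lx ly xy _ _] := hN.
have [i0 hi0 ei0] := idx x hx lx.
have i00 : i0 = 0.
  case: i0 hi0 ei0 => // i hi ei; have [r l] := pP 0 (leq_trans (ltn0Sn _) hi).
  have := hb (p 0); rewrite l -ei => H; have := H _ (mono _ _ (ltn0Sn i) hi).
  by case/andP: r => h _ /(_ h).
subst i0; have [W hW eW] := idx y hy ly.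
have W0 : 0 < W.
  by case: W eW {hW} => // eW; move: xy; rewrite -ei0 -eW ltnn.
have N_e j : j + W < m -> NS k E nd (p j) (p (j + W)).
  elim: j => [|j IH] hj; first by rewrite ei0 add0n eW.
  have hj' : j + W < m by apply: ltnW.
  have hj1 : j.+1 < m by apply: leq_ltn_trans hj; rewrite addSn ltnS leq_addr.
  apply: (hC (p j) (p (j + W))).
  - by case: (pP j (ltnW hj1)).
  - by case: (pP _ hj').
  - by case: (pP _ hj1).
  - by case: (pP _ hj).
  - exact: IH.
  - exact: nxt_e.
  - exact: nxt_e.
exists m, W, (fun j => nd (p j)); split; split=> //.
- by rewrite ei0.
- move=> j /andP[h1 h2]; have hj := ltn_trans h2 hW.
  by apply: hF; [rewrite -ei0; apply: mono | rewrite -eW; apply: mono | case: (pP j hj)].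
- move=> j hj; apply: hH; [by case: (pP _ (ltnW hj)) | by case: (pP _ hj) | exact: nxt_e].
- move=> j hj; have hj1 : j < m by apply: leq_ltn_trans hj; rewrite leq_addr.
  apply: hV; [by case: (pP _ hj1) | by case: (pP _ hj) | exact: N_e].
- by have [j hj ej] := idx xa hxa la; exists j => //; rewrite ej.
Qed.

(** * Addresses: hereditarily finite sets spelled as words *)

Fixpoint HF (A j : nat) : finType := match j with 0 => 'I_A | j'.+1 => {set HF A j'} end.

Lemma card_HF A j : #|HF A j| = tower j A.
Proof. by elim: j => [|j IH] /=; rewrite ?card_ord // -cardsT -powersetT card_powerset cardsT IH. Qed.

(* A word of nodes whose last one is the only node of level at least [j]. *)
Definition capped (lv : nat -> nat) (j : nat) (s : seq nat) : bool :=
  [&& 0 < size s, all (fun u => lv u < j) (belast (head 0 s) (behead s)) & j <= lv (last 0 s)].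

Section Capped.
Variables (lv : nat -> nat) (X : Type) (f : X -> seq nat) (j : nat).
Hypothesis cf : forall q, capped lv j (f q).

Lemma cappedE s : capped lv j s -> exists b t, [/\ s = rcons b t, all (fun u => lv u < j) b & j <= lv t].
Proof.
case: s => // a s /and3P[_ /= h1 h2]; exists (belast a s), (last a s).
by rewrite -lastI.
Qed.

Lemma capped_rcons b t : all (fun u => lv u < j) b -> j <= lv t -> capped lv j (rcons b t).
Proof.
move=> h1 h2; rewrite /capped size_rcons /= last_rcons h2 andbT.
by case: b h1 => [|a b] //= h1; rewrite belast_rcons.
Qed.

(** Reads the elements of a set off its word: in a concatenation of capped words, a node of level at
    least [j] can only be the last node of one of them. *)
Lemma capped_flatten s : forall u, 0 < u -> u <= size (flatten (map f s)) ->
  j <= lv (nth 0 (flatten (map f s)) u.-1) ->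
  exists s1 q s2, s = s1 ++ q :: s2 /\ u = size (flatten (map f (rcons s1 q))).
Proof.
elim: s => [|q s IH] u u0 /=; first by rewrite leqNgt u0.
have [b [t [eq hb ht]]] := cappedE (cf q).
rewrite size_cat nth_cat => hu; case: ltnP => h.
  rewrite eq nth_rcons; case: ltnP => h2.
    by rewrite leqNgt (allP hb) // mem_nth.
  move=> _; exists [::], q, s; split=> //=; rewrite cats0.
  by move: h h2; rewrite eq size_rcons; lia.
have h0 : 0 < u - size (f q) by lia.
have -> : u.-1 - size (f q) = (u - size (f q)).-1 by lia.
case/(IH _ h0); first by lia.
move=> s1 [q' [s2 [-> e]]]; exists (q :: s1), q', s2; split=> //=.
by rewrite size_cat -e; lia.
Qed.

Lemma last_flatten_capped a s q : j <= lv (last a (flatten (map f (rcons s q)))).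
Proof.
rewrite map_rcons flatten_rcons last_cat.
by have [b [t [-> _ h]]] := cappedE (cf q); rewrite last_rcons.
Qed.

End Capped.

(** * Completeness: from a tiling to a path *)

Section Complete.
Variables (M : TM) (k0 : nat) (w : seq bool) (A : nat).
Let k := k0.+1.
Let E := edge M k w.

Definition lvl (u : nat) : nat := level (ncl M k w u).

Lemma E_lev j u : E (6 + j) u u = (j <= lvl u).
Proof. by rewrite /E /edge /= eqxx. Qed.

Definition hmark (j : nat) : nat := cnode w (inl (inord j) : cst M k).

Lemma lvl_hmark j : j < k -> lvl (hmark j) = j.
Proof. by move=> hj; rewrite /lvl /hmark ncl_cnode /= inordK. Qed.

Fixpoint hword (j : nat) : HF A j -> seq nat :=
  match j return HF A j -> seq nat with
  | 0 => fun a => [:: anode M k w (nat_of_ord a)]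
  | j'.+1 => fun S => rcons (flatten [seq hword q | q <- enum S]) (hmark j'.+1)
  end.

(** The closing marker is left out because, at the top level, the node of the cell itself takes its
    place. *)
Definition hbody (j : nat) (S : {set HF A j}) : seq nat := flatten [seq hword q | q <- enum S].

Lemma hword_capped j : j < k -> forall q : HF A j, capped lvl j (hword q) && all (fun u => lvl u <= j) (hword q).
Proof.
elim: j => [|j IH] hj q.
  by rewrite /capped /= /lvl ncl_anode.
have hb : all (fun u => lvl u < j.+1) (hbody q).
  rewrite /hbody; elim: (enum _) => //= a s IHs; rewrite all_cat IHs andbT.
  by case/andP: (IH (ltnW hj) a).
rewrite /= capped_rcons ?lvl_hmark // all_rcons lvl_hmark // leqnn /=.
by apply: sub_all hb => u /ltnW.
Qed.

Lemma hbody_lv j (S : {set HF A j}) : j < k -> all (fun u => lvl u <= j) (hbody S).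
Proof.
move=> hj; rewrite /hbody; elim: (enum _) => //= a s IHs; rewrite all_cat IHs andbT.
by case/andP: (hword_capped hj a).
Qed.

(** Keeps what stands in front of a word from being read as a part of it. *)
Definition delim (j : nat) (pre : seq nat) := pre = [::] \/ j <= lvl (last 0 pre).

Section Fixed.
Variables (ws : seq nat) (x0 : nat).
Let nd (i : nat) : nat := nth x0 ws i.-1.

(** All nodes of the body have level at most [j], and [delim] stops the search for elements at the
    end of [pre]; within the body, nodes of level [j] are exactly the ends of the words of the
    elements. *)
Lemma blkSP j (S : {set HF A j}) pre x suf u : j < k -> ws = pre ++ hbody S ++ x :: suf ->
  delim j.+1 pre ->
  blkS E nd j u (size (pre ++ hbody S)).+1 <->
  exists s1 q s2, enum S = s1 ++ q :: s2 /\
    u = size (pre ++ flatten [seq hword q | q <- rcons s1 q]).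
Proof.
move=> hj ews hd.
have cap q : capped lvl j (@hword j q) by case/andP: (hword_capped hj q).
have ndb z : size pre < z -> z <= size (pre ++ hbody S) -> nd z = nth 0 (hbody S) (z.-1 - size pre).
  move=> h1 h2; rewrite /nd ews catA nth_cat ifT; last by lia.
  rewrite nth_cat ifF; last by apply/negbTE; lia.
  apply: set_nth_default.
  by rewrite ltn_subLR -?size_cat; [case: (z) h1 h2 | case: (z) h1].
split.
  case=> u0 ux lu hz; rewrite /levS E_lev in lu.
  (* Otherwise the last node of [pre], of level at least [j.+1], would lie between [u] and the
     closing node. *)
  have hu : size pre < u.
    rewrite ltnNge; apply/negP => h; case: hd => hd; first by move: h; rewrite hd /=; lia.
    have := hz (size pre) h; rewrite size_cat ltnS leq_addr /levS E_lev => /(_ isT).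
    rewrite /nd ews nth_cat ifT; last by lia.
    by rewrite (set_nth_default 0) ?nth_last ?hd //; lia.
  rewrite ndb // in lu.
  have e : u.-1 - size pre = (u - size pre).-1 by lia.
  rewrite e in lu.
  have [||s1 [q [s2 [es eu]]]] := capped_flatten cap _ _ lu; first by lia.
    by rewrite leq_subLR -size_cat.
  by exists s1, q, s2; split=> //; rewrite size_cat -eu; lia.
move=> [s1 [q [s2 [es ->]]]].
have szle : size (flatten [seq hword q | q <- rcons s1 q]) <= size (hbody S).
  by rewrite /hbody es -cat_rcons map_cat flatten_cat size_cat leq_addr.
have [b [t [eb _ ht]]] := cappedE (cap q).
have sz0 : 0 < size (flatten [seq hword q | q <- rcons s1 q]).
  by rewrite map_rcons flatten_rcons size_cat eb size_rcons; lia.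
split.
- by rewrite size_cat; lia.
- by rewrite !size_cat ltnS leq_add2l.
- rewrite /levS E_lev ndb ?size_cat ?leq_add2l //; last by lia.
  have -> : (size pre + size (flatten [seq hword q0 | q0 <- rcons s1 q])).-1 - size pre =
            (size (flatten [seq hword q0 | q0 <- rcons s1 q])).-1 by lia.
  rewrite /hbody es -cat_rcons map_cat flatten_cat nth_cat ifT; last by lia.
  by rewrite nth_last last_flatten_capped.
- move=> z hz1 hz2; rewrite /levS E_lev -leqNgt.
  rewrite size_cat in hz1; rewrite ltnS in hz2; rewrite ndb //; last by lia.
  apply: (allP (hbody_lv S hj)); apply: mem_nth.
  have hz : size pre < z by lia.
  by rewrite ltn_subLR -?size_cat; [case: (z) hz hz2 | case: (z) hz].
Qed.

Lemma delim_flatten j pre s : j < k -> delim j.+1 pre ->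
  delim j (pre ++ flatten [seq @hword j q | q <- s]).
Proof.
move=> hj hd; case/lastP: s => [|s q].
  by rewrite cats0; case: hd => h; [left | right; apply: ltnW].
right; rewrite last_cat; apply: last_flatten_capped => q'.
by case/andP: (hword_capped hj q').
Qed.

(** Extensionality of sets, given the claim for their elements. The closing nodes [x1] and [x2] are
    arbitrary, so that the lemma serves both for marked words and for cells. *)
Lemma RS_hbody j (hj : j < k) :
  (forall (q1 q2 : HF A j) pre1 pre2 suf1 suf2,
     ws = pre1 ++ hword q1 ++ suf1 -> ws = pre2 ++ hword q2 ++ suf2 -> delim j pre1 -> delim j pre2 ->
     RS E nd j (size (pre1 ++ hword q1)) (size (pre2 ++ hword q2)) <-> q1 = q2) ->
  forall (S1 S2 : {set HF A j}) pre1 pre2 x1 x2 suf1 suf2,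
     ws = pre1 ++ hbody S1 ++ x1 :: suf1 -> ws = pre2 ++ hbody S2 ++ x2 :: suf2 ->
     delim j.+1 pre1 -> delim j.+1 pre2 ->
     RS E nd j.+1 (size (pre1 ++ hbody S1)).+1 (size (pre2 ++ hbody S2)).+1 <-> S1 = S2.
Proof.
move=> IH S1 S2 pre1 pre2 x1 x2 suf1 suf2 e1 e2 d1 d2.
have occ (S : {set HF A j}) pre x suf s1 q s2 : ws = pre ++ hbody S ++ x :: suf ->
    enum S = s1 ++ q :: s2 ->
    ws = (pre ++ flatten [seq hword q | q <- s1]) ++ hword q ++
         (flatten [seq hword q | q <- s2] ++ x :: suf).
  by move=> -> es; rewrite /hbody es map_cat flatten_cat /= -!catA.
have szr pre s1 (q : HF A j) : size (pre ++ flatten [seq hword q | q <- rcons s1 q]) =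
    size ((pre ++ flatten [seq hword q | q <- s1]) ++ hword q).
  by rewrite map_rcons flatten_rcons catA.
(* One inclusion. The disjunction is needed because [RS] always takes its first argument from the
   same side, so the two inclusions see opposite orders. *)
have half (S S' : {set HF A j}) pre pre' x x' suf suf' :
    ws = pre ++ hbody S ++ x :: suf -> ws = pre' ++ hbody S' ++ x' :: suf' ->
    delim j.+1 pre -> delim j.+1 pre' ->
    (forall u, blkS E nd j u (size (pre ++ hbody S)).+1 ->
       exists2 v, blkS E nd j v (size (pre' ++ hbody S')).+1 & RS E nd j u v \/ RS E nd j v u) ->
    S \subset S'.
  move=> e e' d d' H; apply/subsetP => q; rewrite -mem_enum => /path.splitPr es.
  have [s1 [s2 {}es]] : exists s1 s2, enum S = s1 ++ q :: s2.
    by case: es => s1 s2; exists s1, s2.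
  have [|v /(blkSP v hj e' d')[s1' [q' [s2' [es' ->]]]]] := H (size (pre ++ flatten [seq hword q | q <- rcons s1 q])).
    by apply/(blkSP _ hj e d); exists s1, q, s2.
  have o := occ _ _ _ _ _ _ _ e es; have o' := occ _ _ _ _ _ _ _ e' es'.
  have dl := delim_flatten s1 hj d; have dl' := delim_flatten s1' hj d'.
  have q'S : q' \in S' by rewrite -mem_enum es' mem_cat inE eqxx orbT.
  rewrite !szr => -[] h; first by move: ((IH _ _ _ _ _ _ o o' dl dl').1 h) => ->.
  by move: ((IH _ _ _ _ _ _ o' o dl' dl).1 h) => <-.
split=> [[H1 H2]|eS].
  apply/eqP; rewrite eqEsubset; apply/andP; split.
    by apply: (half _ _ _ _ _ _ _ _ e1 e2 d1 d2) => u /H1[v hv hR]; exists v => //; left.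
  by apply: (half _ _ _ _ _ _ _ _ e2 e1 d2 d1) => u /H2[v hv hR]; exists v => //; right.
have other (pre pre' : seq nat) x x' suf suf' : ws = pre ++ hbody S1 ++ x :: suf -> ws = pre' ++ hbody S1 ++ x' :: suf' ->
    delim j.+1 pre -> delim j.+1 pre' -> 
    forall u, blkS E nd j u (size (pre ++ hbody S1)).+1 ->
       exists2 v, blkS E nd j v (size (pre' ++ hbody S1)).+1 & RS E nd j u v /\ RS E nd j v u.
  move=> e e' d d' u /(blkSP u hj e d)[s1 [q [s2 [es ->]]]].
  exists (size (pre' ++ flatten [seq hword q | q <- rcons s1 q])).
    by apply/(blkSP _ hj e' d'); exists s1, q, s2.
  have o := occ _ _ _ _ _ _ _ e es; have o' := occ _ _ _ _ _ _ _ e' es.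
  have dl := delim_flatten s1 hj d; have dl' := delim_flatten s1 hj d'.
  by rewrite !szr; split; [apply/(IH _ _ _ _ _ _ o o' dl dl') | apply/(IH _ _ _ _ _ _ o' o dl' dl)].
subst S2; split=> u.
  by move/(other _ _ _ _ _ _ e1 e2 d1 d2) => [v hv []]; exists v.
by move/(other _ _ _ _ _ _ e2 e1 d2 d1) => [v hv []]; exists v.
Qed.

Lemma RS_hword j : j < k -> forall (q1 q2 : HF A j) pre1 pre2 suf1 suf2,
  ws = pre1 ++ hword q1 ++ suf1 -> ws = pre2 ++ hword q2 ++ suf2 -> delim j pre1 -> delim j pre2 ->
  RS E nd j (size (pre1 ++ hword q1)) (size (pre2 ++ hword q2)) <-> q1 = q2.
Proof.
elim: j => [|j IH] hj q1 q2 pre1 pre2 suf1 suf2.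
  move=> /= e1 e2 _ _; rewrite !size_cat /= !addn1 /nd /=.
  rewrite {1}e1 e2 !nth_cat !ltnn !subnn /=.
  split=> [|-> //]; rewrite /anode => /eqP; rewrite eqn_add2l => /eqP h.
  exact: val_inj.
move=> e1 e2 d1 d2.
have hj' := ltnW hj.
have := @RS_hbody j hj' (IH hj') q1 q2 pre1 pre2 (hmark j.+1) (hmark j.+1) suf1 suf2.
rewrite /= !cat_rcons in e1 e2 * => /(_ e1 e2 d1 d2).
by rewrite -!rcons_cat !size_rcons.
Qed.

End Fixed.

Variables (W m : nat) (tau : nat -> nat).
Hypotheses (W0 : 0 < W) (WA : W <= tower k A).
Hypothesis tau_lv : forall j, k <= lvl (tau j).
Hypothesis tau_tiling : tiling M k w m W tau.

Definition addr (i : nat) : {set HF A k0} := nth set0 (enum (HF A k)) i.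

Lemma addr_inj i j : i < W -> j < W -> addr i = addr j -> i = j.
Proof.
move=> hi hj; have sz : size (enum (HF A k)) = tower k A by rewrite -cardE card_HF.
by move/eqP; rewrite nth_uniq ?sz ?enum_uniq ?(leq_trans hi) ?(leq_trans hj) // => /eqP.
Qed.

(** The address encodes the column, hence cells of one column share it. *)
Definition cword (j : nat) : seq nat := rcons (hbody (addr (j %% W))) (tau j).
Definition cprefix (j : nat) : seq nat := flatten [seq cword i | i <- iota 0 j].
Definition cpos (j : nat) : nat := size (cprefix j.+1).
Definition cpath : seq nat := cprefix m.
Notation ws := cpath.
Variable x0 : nat.
Let nd (i : nat) : nat := nth x0 ws i.-1.

Lemma cword_capped j : capped lvl k (cword j).
Proof.
apply: capped_rcons => //.
by have := @hbody_lv k0 (addr (j %% W)) (leqnn _); apply: sub_all.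
Qed.

Lemma cprefixS j : cprefix j.+1 = cprefix j ++ cword j.
Proof. by rewrite /cprefix -addn1 iotaD map_cat flatten_cat /= cats0. Qed.

Lemma cposS j : cpos j = (size (cprefix j ++ hbody (addr (j %% W)))).+1.
Proof. by rewrite /cpos cprefixS /cword -rcons_cat size_rcons. Qed.

Lemma delim_cprefix j : delim k (cprefix j).
Proof.
case: j => [|j]; first by left.
by right; rewrite cprefixS last_cat /cword last_rcons.
Qed.

Lemma ws_split j : j < m -> exists suf, ws = cprefix j ++ hbody (addr (j %% W)) ++ tau j :: suf.
Proof.
move=> hj; exists (flatten [seq cword i | i <- iota j.+1 (m - j.+1)]).
rewrite /ws /cprefix -{1}(subnKC hj) iotaD map_cat flatten_cat add0n.
by rewrite -/(cprefix j.+1) cprefixS -catA /cword cat_rcons.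
Qed.

Lemma cpos_ltS j : cpos j < cpos j.+1.
Proof. by rewrite /cpos (cprefixS j.+1) size_cat /cword size_rcons; lia. Qed.

Lemma cpos_lt i j : (cpos i < cpos j) = (i < j).
Proof. exact: (leqW_mono (leq_mono (homo_ltn ltn_trans cpos_ltS))). Qed.

Lemma cpos_range j : j < m -> inrange (size ws) (cpos j).
Proof.
move=> hj; have [suf e] := ws_split hj.
by rewrite /inrange cposS e !size_cat /=; lia.
Qed.

Lemma nd_cpos j : j < m -> nd (cpos j) = tau j.
Proof.
move=> hj; have [suf e] := ws_split hj.
by rewrite /nd e cposS /= catA nth_cat ltnn subnn.
Qed.

Lemma lev_cpos j : j < m -> levS E nd k (cpos j).
Proof. by move=> hj; rewrite /levS E_lev nd_cpos. Qed.

Lemma cposP x : inrange (size ws) x -> levS E nd k x -> exists2 j, j < m & x = cpos j.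
Proof.
move=> /andP[hx0 xl]; rewrite /levS E_lev /nd (set_nth_default 0); last by lia.
move=> lx; have [s1 [j [s2 [es ex]]]] := capped_flatten cword_capped hx0 xl lx.
have hsz : size s1 < m by rewrite -(size_iota 0 m) es size_cat /=; lia.
have hs1 : s1 = iota 0 (size s1) /\ j = size s1.
  have : take (size s1) (iota 0 m) = s1 by rewrite es take_size_cat.
  rewrite take_iota (minn_idPl (ltnW hsz)) => <-; split; first by rewrite size_iota.
  by have := nth_iota 0 0 hsz; rewrite es nth_cat ltnn subnn /= size_iota.
have hj : j < m by rewrite hs1.2.
exists j => //; rewrite ex /cpos /cprefix; case: hs1 => h1 h2.
by rewrite h1 -h2 -[in iota 0 j.+1]addn1 iotaD /= add0n cats1.
Qed.

(** [W <= tower k A] makes the addresses of distinct columns distinct sets, so equality of sets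
    amounts to equality of columns. *)
Lemma RS_cpos i j : i < m -> j < m -> RS E nd k (cpos i) (cpos j) <-> i = j %[mod W].
Proof.
move=> hi hj; have [si ei] := ws_split hi; have [sj ej] := ws_split hj.
rewrite !cposS.
have [H1 H2] := @RS_hbody ws x0 k0 (leqnn _) (@RS_hword ws x0 k0 (leqnn _)) _ _ _ _ _ _ _ _ ei ej (delim_cprefix i) (delim_cprefix j).
split=> [/H1 /addr_inj|h]; first by apply; rewrite ltn_mod.
by apply: H2; rewrite h.
Qed.

Lemma NS_cpos i j : i < m -> j < m -> NS k E nd (cpos i) (cpos j) <-> j = i + W.
Proof.
move=> hi hj; split.
  case=> _ _; rewrite cpos_lt => hij /(RS_cpos hi hj) e H.
  have : W %| j - i by rewrite -eqn_mod_dvd ?(ltnW hij) // eq_sym; apply/eqP.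
  (* Quotient 0 contradicts [i < j] and quotient 1 is the claim; a larger one puts the cell [i + W],
     with the same address, in between. *)
  case/dvdnP => -[|[|c]] ec; [lia | lia |].
  have hl : i + W < j by move: ec; rewrite !mulSn; lia.
  have hlm := ltn_trans hl hj.
  case: (H (cpos (i + W))); rewrite ?cpos_lt //; first by lia.
    exact: lev_cpos.
  by apply/(RS_cpos hi hlm); rewrite modnDr.
move=> ej; split; rewrite ?lev_cpos // ?cpos_lt; first by lia.
  by apply/(RS_cpos hi hj); rewrite ej modnDr.
move=> z hz1 hz2 lz.
have hz : inrange (size ws) z by have := cpos_range hj; rewrite /inrange; lia.
have [l hl ez] := cposP hz lz; subst z; rewrite !cpos_lt in hz1 hz2.
move/(RS_cpos hi hl) => e.
have : W %| l - i by rewrite -eqn_mod_dvd ?(ltnW hz1) // eq_sym; apply/eqP.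
by move/dvdn_leq => /(_ _); lia.
Qed.

Lemma nxtS_cpos i j : i < m -> j < m -> nxtS k E nd (cpos i) (cpos j) -> j = i.+1.
Proof.
move=> hi hj [_ _]; rewrite cpos_lt => hij H.
case: (ltngtP j i.+1) => // hl; first by lia.
have := H (cpos i.+1); rewrite !cpos_lt ltnSn hl lev_cpos; last by lia.
by move=> /(_ isT isT).
Qed.

Lemma PhiS_complete : PhiS k E (size ws) nd.
Proof.
case: tau_tiling => -[_ Wm hS hF] [hH hV [ja hja hA]].
have m0 : 0 < m by lia.
split; last split; last split; last split.
- exists (cpos 0), (cpos W); split.
  + by rewrite !cpos_range.
  + by rewrite nd_cpos.
  + by apply/NS_cpos.
  + move=> z z0 hz; apply/negP => lz.
    have hzr : inrange (size ws) z by have := cpos_range m0; rewrite /inrange; lia.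
    by have [l hl ez] := cposP hzr lz; move: hz; rewrite ez cpos_lt.
  + move=> z hz1 hz2 lz.
    have hzr : inrange (size ws) z by have := cpos_range Wm; rewrite /inrange; lia.
    have [l hl ez] := cposP hzr lz; rewrite ez !cpos_lt in hz1 hz2 *.
    by rewrite nd_cpos //; apply: hF; rewrite hz1.
- move=> x y hx hy hn; have [lx ly _ _] := hn.
  have [i hi ei] := cposP hx lx; have [j hj ej] := cposP hy ly; subst x y.
  by have ej := nxtS_cpos hi hj hn; subst j; rewrite !nd_cpos //; apply: hH.
- move=> x y hx hy hn; have [lx ly _ _ _] := hn.
  have [i hi ei] := cposP hx lx; have [j hj ej] := cposP hy ly; subst x y.
  by move/(NS_cpos hi hj): hn => ej; subst j; rewrite !nd_cpos //; apply: hV.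
- move=> x y x' y' hx hy hx' hy' hn h1 h2; have [lx ly _ _ _] := hn.
  have [_ lx' _ _] := h1; have [_ ly' _ _] := h2.
  have [i hi ei] := cposP hx lx; have [j hj ej] := cposP hy ly; subst x y.
  have [i' hi' ei'] := cposP hx' lx'; have [j' hj' ej'] := cposP hy' ly'; subst x' y'.
  move/(NS_cpos hi hj): hn => ej; have e1 := nxtS_cpos hi hi' h1; have e2 := nxtS_cpos hj hj' h2.
  by apply/(NS_cpos hi' hj'); rewrite e2 ej e1.
- by exists (cpos ja); rewrite cpos_range // lev_cpos // nd_cpos.
Qed.

Lemma hword_le j (T : nat) : anode M k w A <= T -> forall q : HF A j, all (fun u => u < T) (hword q).
Proof.
move=> hT; have hc c : cnode w (c : cst M k) < T.
  by apply: leq_trans hT; rewrite /cnode /anode -addnA -addnS leq_add2l ltn_addr ?ltn_ord.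
elim: j => [|j IH] q /=.
  by rewrite andbT; apply: leq_trans hT; rewrite /anode ltn_add2l.
by rewrite all_rcons hc /=; elim: (enum _) => //= a s IHs; rewrite all_cat IH.
Qed.

Lemma ws_lt T : anode M k w A <= T -> (forall j, tau j < T) -> all (fun u => u < T) ws.
Proof.
move=> hT ht; rewrite /ws /cprefix; elim: (iota _ _) => //= j s IHs.
rewrite all_cat IHs andbT /cword all_rcons ht /= /hbody.
by elim: (enum _) => //= a s' IHs'; rewrite all_cat hword_le.
Qed.

Lemma size_ws : 0 < size ws.
Proof.
have m0 : 0 < m by case: tau_tiling => -[_ Wm _ _] _; lia.
by have := cpos_range m0; rewrite /inrange; lia.
Qed.
End Complete.

(** * Programs over bit-list registers *)

Lemma bitsF_fuel : forall f m, m <= f -> bitsF f m = bits m.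
Proof.
have H : forall m f, m <= f -> forall f', m <= f' -> bitsF f m = bitsF f' m.
  elim/ltn_ind=> -[|m] IH [|f] // hf [|f'] // hf' //=.
  by congr (_ :: _); apply: IH; rewrite ?uphalf_half; lia.
by move=> f m h; apply: H.
Qed.

Lemma bitsE m : 0 < m -> bits m = odd m :: bits m./2.
Proof. by case: m => // m _; rewrite {1}/bits /= bitsF_fuel //; lia. Qed.

Lemma bitsS m : bits m.+1 = incb (bits m).
Proof.
elim/ltn_ind: m => m IH; case: (posnP m) => [->|m0] //.
rewrite bitsE // (bitsE m0) /=; case hm: (odd m) => /=.
  by congr (_ :: _); rewrite uphalf_half hm IH //; lia.
by congr (_ :: bits _); rewrite uphalf_half hm.
Qed.

Lemma size_bits m : size (bits m) <= m.
Proof.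
elim/ltn_ind: m => m IH; case: (posnP m) => [->|m0] //.
by rewrite bitsE //= (leq_ltn_trans (IH _ _)); lia.
Qed.

Lemma rcons_nseq_true i : rcons (nseq i true) true = nseq i.+1 true.
Proof. by elim: i => //= i ->. Qed.

Lemma iota0_rcons i : iota 0 i.+1 = rcons (iota 0 i) i.
Proof. by rewrite -addn1 iotaD cats1. Qed.

(** A total-correctness triple in which [C] bounds the number of sweeps. *)
Definition runs (p : prog) (s : regs) (C : nat) (Q : regs -> Prop) : Prop :=
  exists s' m, [/\ exec p s s' m, m <= C & Q s'].

Lemma runs_op o r s Q : Q (set_nth [::] s r (opf o (nth [::] s r))) -> runs (POp o r) s 1 Q.
Proof. by move=> H; exists (set_nth [::] s r (opf o (nth [::] s r))), 1; split=> //; apply: EOp. Qed.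

Lemma runs_seq p q s C1 C2 Q1 Q2 : runs p s C1 Q1 -> (forall s', Q1 s' -> runs q s' C2 Q2) ->
  runs (PSeq p q) s (C1 + C2) Q2.
Proof.
move=> [s1 [m1 [H1 h1 /[swap] H /H [s2 [m2 [H2 h2 hQ]]]]]].
by exists s2, (m1 + m2); split=> //; [apply: ESeq H1 H2 | apply: leq_add].
Qed.

Lemma runs_weak p s C C' (Q Q' : regs -> Prop) : runs p s C Q -> C <= C' ->
  (forall s', Q s' -> Q' s') -> runs p s C' Q'.
Proof. by move=> [s1 [m1 [H1 h1 hQ]]] h H; exists s1, m1; split; [|lia|apply: H]. Qed.

Lemma runs_opseq o r q s C Q : runs q (set_nth [::] s r (opf o (nth [::] s r))) C Q ->
  runs (PSeq (POp o r) q) s C.+1 Q.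
Proof.
move=> H; rewrite -add1n; apply: runs_seq (runs_op (Q := eq _) erefl) _ => s' <-; exact: H.
Qed.

Lemma runs_if phi c p q s b C Q : test_is phi c s b -> runs (if b then p else q) s C Q ->
  runs (PIf phi c p q) s C.+1 Q.
Proof. by move=> h [s1 [m1 [H1 h1 hQ]]]; exists s1, m1.+1; split=> //; apply: EIf h H1. Qed.

Lemma runs_while phi c p s N C (Inv : nat -> regs -> Prop) : Inv 0 s ->
  (forall i s, i < N -> Inv i s -> test_is phi c s true /\ runs p s C (Inv i.+1)) ->
  (forall s, Inv N s -> test_is phi c s false) ->
  runs (PWhile phi c p) s (N * C.+1 + 1) (Inv N).
Proof.
move=> H0 HS HN.
suff H i s' : i <= N -> Inv (N - i) s' -> runs (PWhile phi c p) s' (i * C.+1 + 1) (Inv N).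
  by apply: (H N) => //; rewrite subnn.
elim: i s' => [|i IH] s' hi.
  by rewrite subn0 => h; exists s', 1; split=> //; apply: EWhileF; apply: HN.
move=> h; have hN : N - i.+1 < N by lia.
have [ht [s1 [m1 [H1 h1 hQ]]]] := HS _ _ hN h.
have e : (N - i.+1).+1 = N - i by lia.
rewrite e in hQ; have [s2 [m2 [H2 h2 hQ2]]] := IH s1 (ltnW hi) hQ.
exists s2, (m1 + m2).+1; split=> //; last by rewrite mulSn; lia.
exact: EWhileT ht H1 H2.
Qed.

(** * Tests on unary registers *)

Definition isS (r : nat) (c : column) : bool := c r != None.

Lemma cnt_sub r1 r2 L : forall f, size (f r1) <= L ->
  cntL (fun c => isS r1 c && ~~ isS r2 c) f L = size (f r1) - size (f r2).
Proof.
elim: L => [|L IH] f hf /=; first by move: hf; rewrite leqn0 size_eq0 => /eqP ->.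
rewrite IH /tailcol ?size_behead; last by lia.
rewrite /isS /headcol; case: (f r1) hf => [|a l1] hf; case: (f r2) => [|b l2] //=; lia.
Qed.

Lemma cnt_isS r L : forall f, size (f r) <= L -> cntL (isS r) f L = size (f r).
Proof.
elim: L => [|L IH] f hf /=; first by move: hf; rewrite leqn0 size_eq0 => /eqP ->.
rewrite IH /tailcol ?size_behead; last by lia.
by rewrite /isS /headcol; case: (f r) hf => [|a l1] hf.
Qed.

(** Column [u] is the only one occupied in both roles at once, filled in [r2] and empty in [r1] with
    [r2] ending there; two unary registers of sizes [u] and [u + 1] thus address a single bit of
    [r3]. *)
Lemma cnt_bit r1 r2 r3 b u L : forall f, size (f r1) = u -> size (f r2) = u.+1 -> u < L ->
  cntL (fun c => [&& ~~ isS r1 c, isS r2 c & c r3 == Some b]) f L = (onth (f r3) u == Some b).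
Proof.
elim: u L => [|u IH] [|L] f h1 h2 hL //=; last first.
  rewrite IH /tailcol ?size_behead ?h1 ?h2 // /isS /headcol.
  have -> /= : ohead (f r1) != None by case: (f r1) h1.
  by case: (f r3) => [|c l] /=; rewrite ?onth0n.
have z f' L' : f' r2 = [::] -> cntL (fun c => [&& ~~ isS r1 c, isS r2 c & c r3 == Some b]) f' L' = 0.
  elim: L' f' => //= L' IHL f' e; rewrite IHL /tailcol ?e // /isS /headcol e /=.
  by rewrite andbF.
rewrite z ?addn0 /isS /headcol /tailcol; last by case: (f r2) h2 => // a [].
by case: (f r1) h1 => //; case: (f r2) h2 => // a l _ _ /=; case: (f r3).
Qed.

Definition ltreg (r1 r2 : nat) : column -> bool := fun c => isS r2 c && ~~ isS r1 c.

Lemma test_ltreg r1 r2 s : test_is (ltreg r1 r2) 1 s (size (nth [::] s r1) < size (nth [::] s r2)).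
Proof. by move=> L hL; rewrite cnt_sub ?subn_gt0. Qed.

(** Branches on the number of columns satisfying [phi], truncated at [C], by testing thresholds from
    above. *)
Fixpoint pcase (phi : column -> bool) (C : nat) (q : nat -> prog) : prog :=
  if C is C'.+1 then PIf phi C (q C) (pcase phi C' q) else q 0.

Lemma runs_pcase phi C q s v B Q :
  (forall L, fits s L -> cntL phi (nth [::] s) L = v) ->
  runs (q (minn C v)) s B Q -> runs (pcase phi C q) s (B + C) Q.
Proof.
move=> hv; elim: C => [|C IH] /=; first by rewrite min0n addn0.
rewrite addnS; case: (leqP C.+1 v) => h H.
  apply: (@runs_if _ _ _ _ _ true); first by move=> L /hv ->.
  by apply: (runs_weak H) => //; rewrite leq_addr.
apply: (@runs_if _ _ _ _ _ false); first by move=> L /hv ->; rewrite leqNgt h.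
by apply: IH; rewrite (minn_idPr _) // -ltnS.
Qed.

Definition pfor (m r : nat) (body : prog) : prog :=
  PSeq (POp OClear m) (PWhile (ltreg m r) 1 (PSeq body (POp (OPush true) m))).

Lemma runs_pfor m r body s N C (Inv : nat -> regs -> Prop) :
  (forall i s, Inv i s -> size (nth [::] s m) = i /\ size (nth [::] s r) = N) ->
  Inv 0 (set_nth [::] s m [::]) ->
  (forall i s, i < N -> Inv i s ->
     runs body s C (fun s' => Inv i.+1 (set_nth [::] s' m (rcons (nth [::] s' m) true)))) ->
  runs (pfor m r body) s (N * C.+2 + 2) (Inv N).
Proof.
move=> hsz H0 HS; rewrite addnS; apply: runs_opseq; apply: runs_while => //.
- move=> i s' hi hI; have [e1 e2] := hsz _ _ hI; split.
    by have := @test_ltreg m r s'; rewrite e1 e2 hi.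
  rewrite -addn1; apply: runs_seq (HS _ _ hi hI) _ => s2 h2; exact: runs_op.
- by move=> s' hI; have [e1 e2] := hsz _ _ hI; have := @test_ltreg m r s'; rewrite e1 e2 ltnn.
Qed.

(** There is no idle instruction; clearing the scratch register 9 serves as one, here and in later
    programs. *)
Fixpoint pushes (r : nat) (l : seq bool) : prog :=
  if l is b :: l' then PSeq (POp (OPush b) r) (pushes r l') else POp OClear 9.

Definition codel (l : seq bool) : seq bool := flatten [seq [:: true; b] | b <- l] ++ [:: false].

Lemma code_codel m : code m = codel (bits m).
Proof. by []. Qed.

Lemma size_codel l : size (codel l) = (size l).*2.+1.
Proof. by rewrite size_cat addn1; elim: l => //= b l [->]; rewrite doubleS. Qed.

(* Registers 9 and 10 form the cursor: at bit [i] they have sizes [i] and [i + 1]. *)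
Definition pprint (r : nat) : prog :=
  PSeq (POp OClear 10) (PSeq (POp (OPush true) 10)
  (PSeq (pfor 9 r (PSeq (PIf (fun c => [&& ~~ isS 9 c, isS 10 c & c r == Some true]) 1
                             (PSeq (POp (OPush true) 1) (POp (OPush true) 1))
                             (PSeq (POp (OPush true) 1) (POp (OPush false) 1)))
                        (POp (OPush true) 10)))
        (POp (OPush false) 1))).

Section Regs.
Variable w : seq bool.

(* Registers: 0 input, 1 output, 2 and 3 unary [u] and [u + 1], 4 unary [v], 5 and 6 binary [u] and
   [v], 7 edge count, 8 binary number of nodes, 9 and 10 print cursor, 11 unary number of nodes;
   [pgrow] uses 12 for its unary base and the registers from 13 on as loop counters. *)
Definition rs (out a2 a3 a4 a5 a6 a7 a8 a9 a10 T : seq bool) (tl : regs) : regs :=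
  [:: w, out, a2, a3, a4, a5, a6, a7, a8, a9, a10, T & tl].

Lemma runs_pprint r out a2 a3 a4 a5 a6 a7 a8 a9 a10 T tl l : 2 <= r <= 8 ->
  nth [::] (rs out a2 a3 a4 a5 a6 a7 a8 a9 a10 T tl) r = l ->
  runs (pprint r) (rs out a2 a3 a4 a5 a6 a7 a8 a9 a10 T tl) (6 * size l + 5)
    (fun s => exists b9 b10, s = rs (out ++ codel l) a2 a3 a4 a5 a6 a7 a8 b9 b10 T tl).
Proof.
move=> hr hl; have hl' o b9 b10 : nth [::] (rs o a2 a3 a4 a5 a6 a7 a8 b9 b10 T tl) r = l.
  by rewrite -hl; move: r hr {hl} => [|[|[|[|[|[|[|[|[|]]]]]]]]].
rewrite addnS addnS; apply: runs_opseq; apply: runs_opseq; rewrite /=.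
have -> : 6 * size l + 3 = (size l * 6 + 2) + 1 by lia.
pose Inv i (s : regs) := s = rs (out ++ flatten [seq [:: true; b] | b <- take i l])
   a2 a3 a4 a5 a6 a7 a8 (nseq i true) (nseq i.+1 true) T tl.
apply: (@runs_seq _ _ _ _ _ (Inv (size l))); last first.
  move=> s ->; apply: runs_op; rewrite /= take_size; exists (nseq (size l) true), (nseq (size l).+1 true).
  by rewrite -cats1 -catA.
apply: runs_pfor.
- by move=> i s ->; rewrite hl' /= size_nseq.
- by rewrite /Inv take0 /= cats0.
move=> i s hi ->.
set b := nth false l i.
have tk : take i.+1 l = rcons (take i l) b by rewrite (take_nth false).
have et : onth l i = Some b by rewrite onthE (nth_map false).
rewrite -[4]/(3 + 1).
apply: (@runs_seq _ _ _ _ _ (fun s => s = rs (out ++ flatten [seq [:: true; b] | b <- take i.+1 l])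
   a2 a3 a4 a5 a6 a7 a8 (nseq i true) (nseq i.+1 true) T tl)); last first.
  by move=> s' ->; apply: runs_op; rewrite /Inv /= !rcons_nseq_true.
apply: (@runs_if _ _ _ _ _ b).
  move=> L hL; rewrite (@cnt_bit 9 10 r true i); first by rewrite hl' et; case: (b).
  - by rewrite /= size_nseq.
  - by rewrite /= size_nseq.
  - by have := hL 10; rewrite /= size_nseq.
have e : flatten [seq [:: true; b] | b <- take i.+1 l] =
    flatten [seq [:: true; b] | b <- take i l] ++ [:: true; b].
  by rewrite tk map_rcons flatten_rcons.
rewrite {}e; case: (b).
  by apply: runs_opseq; apply: runs_op; rewrite /= -!cats1 -!catA.
by apply: runs_opseq; apply: runs_op; rewrite /= -!cats1 -!catA.
Qed.

Lemma runs_pushes l out a2 a3 a4 a5 a6 a7 a8 a9 a10 T tl :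
  runs (pushes 1 l) (rs out a2 a3 a4 a5 a6 a7 a8 a9 a10 T tl) (size l).+1
    (fun s => s = rs (out ++ l) a2 a3 a4 a5 a6 a7 a8 [::] a10 T tl).
Proof.
elim: l out a9 => [|b l IH] out a9 /=; first by apply: runs_op; rewrite cats0.
by apply: runs_opseq; rewrite /= -cat_rcons; apply: IH.
Qed.

(** [d] nested loops over the unary base compute its [d]-th power in unary; each level owns a loop
    counter. *)
Fixpoint pgrow (d : nat) : prog :=
  if d is d'.+1 then pfor d'.+4.+4.+4.+1 12 (pgrow d') else POp (OPush true) 11.

Lemma runs_pgrow d t out a2 a3 a4 a5 a6 a7 a8 a9 a10 base tl : 1 < size base ->
  runs (pgrow d) (rs out a2 a3 a4 a5 a6 a7 a8 a9 a10 (nseq t true) (base :: tl)) ((4 * size base) ^ d)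
    (fun s => exists tl', (forall j, d <= j -> nth [::] tl' j = nth [::] tl j) /\
       s = rs out a2 a3 a4 a5 a6 a7 a8 a9 a10 (nseq (t + size base ^ d) true) (base :: tl')).
Proof.
move=> B1; elim: d t tl => [|d IH] t tl.
  by apply: runs_op; exists tl; split=> //; rewrite /= rcons_nseq_true expn0 addn1.
pose Inv i s := exists tl', [/\ (forall j, d < j -> nth [::] tl' j = nth [::] tl j),
   size (nth [::] tl' d) = i &
   s = rs out a2 a3 a4 a5 a6 a7 a8 a9 a10 (nseq (t + i * size base ^ d) true) (base :: tl')].
apply: (@runs_weak _ _ (size base * ((4 * size base) ^ d).+2 + 2) _ (Inv (size base))); first last.
- by move=> s [tl' [h1 h2 ->]]; exists tl'; split=> //; rewrite expnS.
(* The recurrence is [B * (X + 2) + 2 <= 4 * B * X] for [1 < B] and [0 < X], which explains the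
   factor 4. *)
- have : 0 < (4 * size base) ^ d by rewrite expn_gt0 muln_gt0 (ltnW B1).
  rewrite expnS; move: (_ ^ d) B1 => X; move: (size base) => B hB hX.
  have : B <= B * X by rewrite leq_pmulr.
  by nia.
apply: runs_pfor.
- by move=> i s [tl' [h1 h2 ->]].
- exists (set_nth [::] tl d [::]); split; rewrite ?mul0n ?addn0 //.
    by move=> j hj; rewrite nth_set_nth /= gtn_eqF.
  by rewrite nth_set_nth /= eqxx.
move=> i s hi [tl' [h1 h2 ->]].
apply: (runs_weak (IH _ _)) => // s' [tl2 [h3 ->]].
exists (set_nth [::] tl2 d (rcons (nth [::] tl2 d) true)); split.
- by move=> j hj; rewrite nth_set_nth /= gtn_eqF // h3 ?h1 // ltnW.
- by rewrite nth_set_nth /= eqxx size_rcons h3 // h2.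
- by rewrite /= mulSn (addnC (size base ^ d)) addnA.
Qed.

(** * Deciding and enumerating the edges *)

Variables (M : TM) (k : nat).
Let K := #|cst M k|.
Let n := size w.

(** An edge depends on [u] and [v] only through finitely many truncated counts, so a finite tree of
    tests suffices, and [edgeb] is evaluated at its leaves when the program is built. *)
Definition pdecide (a : nat) (body : prog) : prog :=
  pcase (fun c => isS 2 c && ~~ isS 0 c) K.+1 (fun eu =>
  pcase (fun c => isS 4 c && ~~ isS 0 c) K.+1 (fun ev =>
  pcase (fun c => [&& ~~ isS 2 c, isS 3 c & c 0 == Some true]) 1 (fun b1 =>
  pcase (fun c => [&& ~~ isS 2 c, isS 3 c & c 0 == Some false]) 1 (fun b0 =>
  pcase (isS 2) 1 (fun u0 =>
  pcase (fun c => isS 4 c && ~~ isS 2 c) 2 (fun vu =>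
  pcase (fun c => isS 2 c && ~~ isS 4 c) 1 (fun uv =>
    if edgeb a (cls M k eu) (cls M k ev)
         (if b1 == 1 then Some true else if b0 == 1 then Some false else None)
         (u0 == 0) ((vu == 0) && (uv == 0)) (vu == 1)
    then body else POp OClear 9))))))).

Lemma runs_pdecide a body out u v a5 a6 a7 a8 a9 a10 T tl C Q : 0 < C ->
  (edge M k w a u v ->
   runs body (rs out (nseq u true) (nseq u.+1 true) (nseq v true) a5 a6 a7 a8 a9 a10 T tl) C Q) ->
  (~~ edge M k w a u v ->
   Q (rs out (nseq u true) (nseq u.+1 true) (nseq v true) a5 a6 a7 a8 [::] a10 T tl)) ->
  runs (pdecide a body) (rs out (nseq u true) (nseq u.+1 true) (nseq v true) a5 a6 a7 a8 a9 a10 T tl)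
    (C + 2 * K + 8) Q.
Proof.
move=> C0 H1 H0; set s := rs _ _ _ _ _ _ _ _ _ _ _ _ in H1 *.
have -> : C + 2 * K + 8 = C + 1 + 2 + 1 + 1 + 1 + K.+1 + K.+1 by lia.
have s2 : size (nth [::] s 2) = u by rewrite /= size_nseq.
have s3 : size (nth [::] s 3) = u.+1 by rewrite /= size_nseq.
have s4 : size (nth [::] s 4) = v by rewrite /= size_nseq.
apply: (@runs_pcase _ _ _ _ (u - n)); first by move=> L hL; rewrite (cnt_sub _ (hL 2)) s2.
apply: (@runs_pcase _ _ _ _ (v - n)); first by move=> L hL; rewrite (cnt_sub _ (hL 4)) s4.
apply: (@runs_pcase _ _ _ _ (onth w u == Some true)).
  by move=> L hL; rewrite (cnt_bit _ _ s2 s3) //; have := hL 3; rewrite s3.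
apply: (@runs_pcase _ _ _ _ (onth w u == Some false)).
  by move=> L hL; rewrite (cnt_bit _ _ s2 s3) //; have := hL 3; rewrite s3.
apply: (@runs_pcase _ _ _ _ u); first by move=> L hL; rewrite (cnt_isS (hL 2)).
apply: (@runs_pcase _ _ _ _ (v - u)); first by move=> L hL; rewrite (cnt_sub _ (hL 4)) s2 s4.
apply: (@runs_pcase _ _ _ _ (u - v)); first by move=> L hL; rewrite (cnt_sub _ (hL 2)) s2 s4.
rewrite !cls_cap.
have -> : (if minn 1 (onth w u == Some true) == 1 then Some true
           else if minn 1 (onth w u == Some false) == 1 then Some false else None) = onth w u.
  by case: (onth w u) => [[]|].
have -> : (minn 1 u == 0) = (u == 0) by lia.
have -> : (minn 2 (v - u) == 0) && (minn 1 (u - v) == 0) = (u == v) by lia.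
have -> : (minn 2 (v - u) == 1) = (v == u.+1) by lia.
rewrite -/(ncl M k w u) -/(ncl M k w v) -/(edge M k w a u v).
case: ifP => h; first exact: H1.
by apply: (@runs_weak _ _ 1 _ Q) => //; apply: runs_op; apply: H0; rewrite h.
Qed.

Section Loops.
Variables (T nl : nat) (body : nat -> prog).
Variable eff : nat * nat * nat -> seq bool * nat -> seq bool * nat.
Variable Cb : nat.
Hypothesis Cb0 : 0 < Cb.
Hypothesis Hbody : forall u a v acc a8 a9 a10 tl, u < T -> a < nl -> v < T ->
  runs (body a) (rs acc.1 (nseq u true) (nseq u.+1 true) (nseq v true) (bits u) (bits v) (bits acc.2)
                    a8 a9 a10 (nseq T true) tl) Cb
    (fun s => exists b9 b10, s = rs (eff (u, a, v) acc).1 (nseq u true) (nseq u.+1 true) (nseq v true)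
                 (bits u) (bits v) (bits (eff (u, a, v) acc).2) a8 b9 b10 (nseq T true) tl).

(** The accumulator pairs the output with a count because the loops serve twice: to count the edges,
    whose number comes first in the encoding, and then to print them. *)
Definition estep (acc : seq bool * nat) (e : nat * nat * nat) : seq bool * nat :=
  if edge M k w e.1.2 e.1.1 e.2 then eff e acc else acc.

Definition pvloop (a : nat) : prog :=
  PSeq (POp OClear 6) (pfor 4 11 (PSeq (pdecide a (body a)) (POp OInc 6))).

Let V := T * (Cb + 2 * K + 11) + 3.

Lemma runs_pvloop u a acc a4 a6 a8 a9 a10 tl : u < T -> a < nl ->
  runs (pvloop a) (rs acc.1 (nseq u true) (nseq u.+1 true) a4 (bits u) a6 (bits acc.2)
                      a8 a9 a10 (nseq T true) tl) V
    (fun s => let acc' := foldl estep acc [seq (u, a, v) | v <- iota 0 T] in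
       exists b4 b6 b9 b10, s = rs acc'.1 (nseq u true) (nseq u.+1 true) b4
                 (bits u) b6 (bits acc'.2) a8 b9 b10 (nseq T true) tl).
Proof.
move=> hu ha; rewrite /V addnS; apply: runs_opseq; rewrite /=.
pose Inv i s := let acc' := foldl estep acc [seq (u, a, v) | v <- iota 0 i] in
  exists b9 b10, s = rs acc'.1 (nseq u true) (nseq u.+1 true) (nseq i true)
                 (bits u) (bits i) (bits acc'.2) a8 b9 b10 (nseq T true) tl.
rewrite (_ : Cb + 2 * K + 11 = (Cb + 2 * K + 8 + 1).+2); last by lia.
apply: (runs_weak (Q := Inv T)) (leqnn _) _; last first.
  by move=> s [b9 [b10 ->]]; exists (nseq T true), (bits T), b9, b10.
apply: runs_pfor.
- by move=> i s [b9 [b10 ->]]; rewrite /= !size_nseq.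
- by exists a9, a10.
move=> i s hi [b9 [b10 ->]].
set acc1 := foldl _ _ _.
pose acc2 := estep acc1 (u, a, i).
apply: (@runs_seq _ _ _ _ _ (fun s => exists b9 b10, s = rs acc2.1 (nseq u true) (nseq u.+1 true)
   (nseq i true) (bits u) (bits i) (bits acc2.2) a8 b9 b10 (nseq T true) tl)).
  apply: runs_pdecide => //; rewrite /acc2 /estep /= => h.
    by rewrite h; apply: Hbody.
  by rewrite (negbTE h); exists [::], b10.
move=> s' [c9 [c10 ->]]; apply: runs_op; exists c9, c10.
by rewrite iota0_rcons map_rcons foldl_rcons /= -bitsS rcons_nseq_true.
Qed.

Definition paloop (l : seq nat) : prog :=
  foldr (fun a p => PSeq (pvloop a) p) (POp OClear 9) l.

Lemma runs_paloop l u acc a4 a6 a8 a9 a10 tl : u < T -> all (fun a => a < nl) l ->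
  runs (paloop l) (rs acc.1 (nseq u true) (nseq u.+1 true) a4 (bits u) a6 (bits acc.2)
                      a8 a9 a10 (nseq T true) tl) (size l * V + 1)
    (fun s => let acc' := foldl estep acc [seq (u, a, v) | a <- l, v <- iota 0 T] in
       exists b4 b6 b9 b10, s = rs acc'.1 (nseq u true) (nseq u.+1 true) b4
                 (bits u) b6 (bits acc'.2) a8 b9 b10 (nseq T true) tl).
Proof.
move=> hu; elim: l acc a4 a6 a9 a10 => [|a l IH] acc a4 a6 a9 a10 /=.
  by move=> _; apply: runs_op; exists a4, a6, [::], a10.
case/andP=> ha hl; rewrite mulSn -addnA.
apply: runs_seq (runs_pvloop acc a4 a6 a8 a9 a10 tl hu ha) _ => s' [b4 [b6 [b9 [b10 ->]]]].
by rewrite foldl_cat; apply: IH.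
Qed.

Definition puloop : prog :=
  PSeq (POp OClear 5) (PSeq (POp OClear 3) (PSeq (POp (OPush true) 3)
    (pfor 2 11 (PSeq (paloop (iota 0 nl)) (PSeq (POp OInc 5) (POp (OPush true) 3)))))).

Lemma runs_puloop acc a2 a3 a4 a5 a6 a8 a9 a10 tl :
  runs puloop (rs acc.1 a2 a3 a4 a5 a6 (bits acc.2) a8 a9 a10 (nseq T true) tl)
    (T * (nl * V + 5) + 5)
    (fun s => let acc' := foldl estep acc [seq (ua.1, ua.2, v) | ua <- [seq (u, a) | u <- iota 0 T, a <- iota 0 nl], v <- iota 0 T] in
       exists b2 b3 b4 b5 b6 b9 b10, s = rs acc'.1 b2 b3 b4 b5 b6 (bits acc'.2) a8 b9 b10 (nseq T true) tl).
Proof.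
rewrite 3!addnS; do 3 (apply: runs_opseq); rewrite /=.
pose ls i := [seq (ua.1, ua.2, v) | ua <- [seq (u, a) | u <- iota 0 i, a <- iota 0 nl], v <- iota 0 T].
have lsS i : ls i.+1 = ls i ++ [seq (i, a, v) | a <- iota 0 nl, v <- iota 0 T].
  rewrite /ls iota0_rcons -cats1 allpairs_cat allpairs_cat /= cats0 /=; congr (_ ++ _).
  by elim: (iota 0 nl) => //= a l IH; rewrite IH.
pose Inv i s := let acc' := foldl estep acc (ls i) in
  exists b4 b6 b9 b10, s = rs acc'.1 (nseq i true) (nseq i.+1 true) b4
                 (bits i) b6 (bits acc'.2) a8 b9 b10 (nseq T true) tl.
rewrite (_ : nl * V + 5 = (nl * V + 1 + 2).+2); last by lia.
apply: (runs_weak (Q := Inv T)) (leqnn _) _; last first.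
  by move=> s [b4 [b6 [b9 [b10 ->]]]]; exists (nseq T true), (nseq T.+1 true), b4, (bits T), b6, b9, b10.
apply: runs_pfor.
- by move=> i s [b4 [b6 [b9 [b10 ->]]]]; rewrite /= !size_nseq.
- by exists a4, a6, a9, a10.
move=> i s hi [b4 [b6 [b9 [b10 ->]]]].
have hl : all (fun a => a < nl) (iota 0 nl) by apply/allP => a; rewrite mem_iota.
have := runs_paloop (foldl estep acc (ls i)) b4 b6 a8 b9 b10 tl hi hl; rewrite size_iota => H.
apply: runs_seq H _ => s' [c4 [c6 [c9 [c10 ->]]]].
apply: runs_opseq; apply: runs_op; exists c4, c6, c9, c10.
by rewrite /= -bitsS !rcons_nseq_true lsS foldl_cat.
Qed.

End Loops.

End Regs.

(** * Printing the graph *)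

Lemma enum_prodE (T1 T2 : finType) :
  enum {: T1 * T2} = [seq (x1, x2) | x1 <- enum T1, x2 <- enum T2].
Proof. by rewrite [LHS]enumT unlock. Qed.

Section Main.
Variables (M : TM) (k D : nat).
Let nl := nlab k.

Definition nnodes (w : seq bool) : nat := (size w).+2 ^ D.

Definition dgr (w : seq bool) : dgraph nl :=
  @DGraph nl (nnodes w) [set e : 'I_(nnodes w) * 'I_nl * 'I_(nnodes w) | edge M k w e.1.2 e.1.1 e.2]
    (fun i => i).

Definition triples (T : nat) : seq (nat * nat * nat) :=
  [seq (ua.1, ua.2, v) | ua <- [seq (u, a) | u <- iota 0 T, a <- iota 0 nl], v <- iota 0 T].

Definition edges (w : seq bool) : seq (nat * nat * nat) :=
  [seq e <- triples (nnodes w) | edge M k w e.1.2 e.1.1 e.2].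

Definition natt (T s : nat) (e : 'I_T * 'I_s * 'I_T) : nat * nat * nat :=
  (nat_of_ord e.1.1, nat_of_ord e.1.2, nat_of_ord e.2).

(** The encoding follows the order of [enum], which has to be the order of the nested loops: source,
    label, target. *)
Lemma natt_enum T : map (@natt T nl) (enum {: 'I_T * 'I_nl * 'I_T}) = triples T.
Proof.
rewrite !enum_prodE /triples -!val_enum_ord.
have -> : [seq (u, a) | u <- map val (enum 'I_T), a <- map val (enum 'I_nl)] =
   map (fun p => (val p.1, val p.2)) [seq (u, a) | u <- enum 'I_T, a <- enum 'I_nl].
  by elim: (enum 'I_T) => //= u l ->; rewrite map_cat -!map_comp.
move: [seq (u, a) | u <- enum 'I_T, a <- enum 'I_nl] => lp.
by elim: lp => //= p l <-; rewrite map_cat -!map_comp.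
Qed.

Lemma edges_enum w : map (@natt _ _) (enum (dE (dgr w))) = edges w.
Proof.
have -> : enum (dE (dgr w)) = 
    filter (fun e : 'I_(nnodes w) * 'I_nl * 'I_(nnodes w) => edge M k w e.1.2 e.1.1 e.2)
      (enum {: 'I_(nnodes w) * 'I_nl * 'I_(nnodes w)}).
  rewrite [in RHS]enumT {1}/enum_mem; apply: eq_filter => e.
  by rewrite -[LHS]/(e \in dE (dgr w)) /= inE.
by rewrite /edges -natt_enum filter_map.
Qed.

Definition pbase : prog :=
  PSeq (POp OClear 12) (PSeq (pfor 2 0 (POp (OPush true) 12))
    (PSeq (POp (OPush true) 12) (POp (OPush true) 12))).

Definition pedge (a : nat) : prog := PSeq (pprint 5) (PSeq (pushes 1 (code a)) (pprint 6)).

Definition pmain : prog :=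
  PSeq pbase (PSeq (pgrow D) (PSeq (pfor 2 11 (POp OInc 8))
  (PSeq (puloop M k nl (fun _ => POp OInc 7))
  (PSeq (pprint 8) (PSeq (pprint 7)
  (PSeq (puloop M k nl pedge)
  (PSeq (POp OClear 5) (pfor 2 11 (PSeq (pprint 5) (POp OInc 5)))))))))).

Lemma runs_pbase w : runs pbase [:: w] (3 * size w + 5) (fun s => exists a2,
  s = rs w [::] a2 [::] [::] [::] [::] [::] [::] [::] [::] [::] [:: nseq (size w).+2 true]).
Proof.
rewrite addnS; apply: runs_opseq; rewrite /=.
have -> : 3 * size w + 4 = (size w * 3 + 2) + 2 by lia.
pose Inv i s := s = rs w [::] (nseq i true) [::] [::] [::] [::] [::] [::] [::] [::] [::] [:: nseq i true].
apply: (@runs_seq _ _ _ _ _ (Inv (size w))); last first.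
  move=> s ->; apply: runs_opseq; apply: runs_op; exists (nseq (size w) true).
  by rewrite /= !rcons_nseq_true.
apply: runs_pfor.
- by move=> i s ->; rewrite /= size_nseq.
- by [].
by move=> i s hi ->; apply: runs_op; rewrite /Inv /= !rcons_nseq_true.
Qed.

Section Run.
Variable w : seq bool.
Let T := nnodes w.
Let K := #|cst M k|.

Definition eff1 (e : nat * nat * nat) (acc : seq bool * nat) := (acc.1, acc.2.+1).
Definition code3 (e : nat * nat * nat) := code e.1.1 ++ code e.1.2 ++ code e.2.
Definition eff2 (e : nat * nat * nat) (acc : seq bool * nat) := (acc.1 ++ code3 e, acc.2).

Lemma foldl_eff1 l acc : foldl (estep w M k eff1) acc l =
  (acc.1, acc.2 + size [seq e <- l | edge M k w e.1.2 e.1.1 e.2]).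
Proof.
elim: l acc => [|e l IH] acc /=; first by rewrite addn0; case: acc.
by rewrite IH /estep; case: ifP => //= _; rewrite addnS.
Qed.

Lemma foldl_eff2 l acc : foldl (estep w M k eff2) acc l =
  (acc.1 ++ flatten (map code3 [seq e <- l | edge M k w e.1.2 e.1.1 e.2]), acc.2).
Proof.
elim: l acc => [|e l IH] acc /=; first by rewrite cats0; case: acc.
by rewrite IH /estep; case: ifP => //= _; rewrite catA.
Qed.

Definition outw : seq bool :=
  code T ++ code (size (edges w)) ++ flatten (map code3 (edges w)) ++ flatten [seq code i | i <- iota 0 T].

Let V Cb := T * (Cb + 2 * K + 11) + 3.
Let U Cb := T * (nl * V Cb + 5) + 5.
Let Cp := 12 * T + 2 * nl + 14.

Definition pcost : nat :=
  (3 * size w + 5) + ((4 * (size w).+2) ^ D + ((T * 3 + 2) + (U 1 + ((6 * T + 5) +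
  ((6 * size (edges w) + 5) + (U Cp + (T * (6 * T + 5 + 1).+2 + 2).+1)))))).

Lemma runs_pmain : runs pmain [:: w] pcost (fun s => nth [::] s 1 = outw).
Proof.
apply: runs_seq (runs_pbase w) _ => s [a2 ->].
have hb : 1 < size (nseq (size w).+2 true) by rewrite size_nseq.
have := @runs_pgrow w D 0 [::] a2 [::] [::] [::] [::] [::] [::] [::] [::] _ [::] hb.
rewrite size_nseq => H; apply: runs_seq H _ => _ [tl [_ ->]].
rewrite add0n -/(nnodes w) -/T.
set tl' := _ :: tl.
apply: (@runs_seq _ _ _ _ _ (fun s => exists a2, s = rs w [::] a2 [::] [::] [::] [::] [::] (bits T) [::] [::] (nseq T true) tl')).
  pose Inv i s := s = rs w [::] (nseq i true) [::] [::] [::] [::] [::] (bits i) [::] [::] (nseq T true) tl'.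
  apply: (runs_weak (Q := Inv T)) (leqnn _) _; last by move=> s' ->; exists (nseq T true).
  apply: runs_pfor => //; first by move=> i s' ->; rewrite /= !size_nseq.
  by move=> i s' hi ->; apply: runs_op; rewrite /Inv /= rcons_nseq_true bitsS.
move=> _ [{}a2 ->].
have H1 := @runs_puloop w M k T nl (fun _ => POp OInc 7) eff1 1 isT _
  ([::], 0) a2 [::] [::] [::] [::] (bits T) [::] [::] tl'.
apply: runs_seq (H1 _) _ => {H1}.
  move=> u a v acc a8 a9 a10 tl0 _ _ _; apply: runs_op; exists a9, a10.
  by rewrite /= -bitsS.
rewrite -/(triples T) foldl_eff1 /= add0n -/(edges w).
move=> _ [b2 [b3 [b4 [b5 [b6 [b9 [b10 ->]]]]]]].
have HT : 6 * size (bits T) + 5 <= 6 * T + 5 by rewrite leq_add2r leq_mul2l size_bits.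
apply: runs_seq (runs_weak (@runs_pprint w 8 _ _ _ _ _ _ _ _ _ _ _ _ _ isT erefl) HT (fun s h => h)) _.
move=> _ [c9 [c10 ->]].
have HE : 6 * size (bits (size (edges w))) + 5 <= 6 * size (edges w) + 5 by rewrite leq_add2r leq_mul2l size_bits.
apply: runs_seq (runs_weak (@runs_pprint w 7 _ _ _ _ _ _ _ _ _ _ _ _ _ isT erefl) HE (fun s h => h)) _.
move=> _ [d9 [d10 ->]]; rewrite -!code_codel /=.
set out0 := code T ++ _.
have H2 := @runs_puloop w M k T nl pedge eff2 Cp _ _
  (out0, size (edges w)) b2 b3 b4 b5 b6 (bits T) d9 d10 tl'.
apply: runs_seq (H2 _ _) _ => {H2}.
- by rewrite /Cp; lia.
- move=> u a v acc a8 a9 a10 tl0 hu ha hv.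
  have -> : Cp = (6 * T + 5) + ((2 * nl + 4) + (6 * T + 5)) by rewrite /Cp; lia.
  have Hu : 6 * size (bits u) + 5 <= 6 * T + 5.
    by rewrite leq_add2r leq_mul2l (leq_trans (size_bits _)) // ltnW.
  have Hv : 6 * size (bits v) + 5 <= 6 * T + 5.
    by rewrite leq_add2r leq_mul2l (leq_trans (size_bits _)) // ltnW.
  apply: runs_seq (runs_weak (@runs_pprint w 5 _ _ _ _ _ _ _ _ _ _ _ _ _ isT erefl) Hu (fun s h => h)) _.
  move=> _ [e9 [e10 ->]].
  apply: (runs_seq (runs_weak (runs_pushes _ _ _ _ _ _ _ _ _ _ _ _ _ _) _ (fun s h => h))).
    by rewrite code_codel size_codel; have := size_bits a; lia.
  move=> _ ->.
  apply: (runs_weak (@runs_pprint w 6 _ _ _ _ _ _ _ _ _ _ _ _ _ isT erefl) Hv) => _ [f9 [f10 ->]].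
  by exists f9, f10; rewrite /= -!code_codel /code3 -!catA.
rewrite -/(triples T) foldl_eff2 /= -/(edges w).
move=> _ [g2 [g3 [g4 [g5 [g6 [g9 [g10 ->]]]]]]].
set out1 := out0 ++ _.
apply: runs_opseq; rewrite /=.
pose Inv i s := exists h9 h10, s = rs w (out1 ++ flatten [seq code j | j <- iota 0 i]) (nseq i true)
  g3 g4 (bits i) g6 (bits (size (edges w))) (bits T) h9 h10 (nseq T true) tl'.
apply: (runs_weak (Q := Inv T)) (leqnn _) _; last first.
  by move=> _ [h9 [h10 ->]]; rewrite /= /outw /out1 /out0 -!catA.
apply: runs_pfor.
- by move=> i s' [h9 [h10 ->]]; rewrite /= !size_nseq.
- by exists g9, g10; rewrite /= cats0.
move=> i s' hi [h9 [h10 ->]].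
have Hi : 6 * size (bits i) + 5 <= 6 * T + 5.
  by rewrite leq_add2r leq_mul2l (leq_trans (size_bits _)) // ltnW.
apply: runs_seq (runs_weak (@runs_pprint w 5 _ _ _ _ _ _ _ _ _ _ _ _ _ isT erefl) Hi (fun s h => h)) _.
move=> _ [e9 [e10 ->]]; apply: runs_op; exists e9, e10.
by rewrite iota0_rcons map_rcons flatten_rcons /= -bitsS rcons_nseq_true -code_codel -catA.
Qed.

Lemma enc_dgr : enc (dgr w) = outw.
Proof.
rewrite /enc /outw -edges_enum size_map -cardE; congr (_ ++ (_ ++ (_ ++ _))).
  by rewrite -map_comp.
by rewrite -val_enum_ord -map_comp.
Qed.

End Run.

Lemma size_edges w : size (edges w) <= nnodes w * nl * nnodes w.
Proof.
rewrite /edges size_filter; apply: (leq_trans (count_size _ _)).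
by rewrite /triples !size_allpairs !size_iota.
Qed.

Hypothesis D0 : 0 < D.

(** Printing the edges dominates: [T * nl * T] candidate triples with a number of sweeps linear in
    [T] each, where [T] is the number of nodes; whence the exponent [3 * D]. *)
Lemma pcost_le : exists C E, forall w, pcost w <= C * (size w).+2 ^ E.
Proof.
pose K := #|cst M k|; pose a := 2 * nl + 2 * K + 40.
exists (4 ^ D + 2 * (nl * a) + 6 * nl + 100), (3 * D) => w.
have hE := size_edges w; rewrite /pcost -/nl -/K.
set T := nnodes w in hE *; set n := size w.
have hT1 : n.+2 <= T by rewrite /T /nnodes -{1}(expn1 n.+2) leq_exp2l.
have -> : (4 * n.+2) ^ D = 4 ^ D * T by rewrite expnMn.
rewrite (mulnC 3 D) expnM -[n.+2 ^ D]/T.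
have T0 : 0 < T by lia.
set T2 := T * T; have h2 : T <= T2 by rewrite leq_pmull.
have -> : T ^ 3 = T * T2 by rewrite /T2 mulnn -expnS.
set T3 := T * T2; have h3 : T2 <= T3 by rewrite leq_pmull.
pose V Cb := T * (Cb + 2 * K + 11) + 3; pose U Cb := T * (nl * V Cb + 5) + 5.
have hV Cb : Cb <= 12 * T + 2 * nl + 14 -> V Cb <= a * T2.
  move=> hC; have hTl m : T * m <= m * T2 by rewrite mulnC leq_mul2l h2 orbT.
  apply: (@leq_trans (T * (12 * T + 2 * nl + 14 + 2 * K + 11) + 3)).
    by rewrite leq_add2r leq_mul2l; apply/orP; right; lia.
  have -> : 12 * T + 2 * nl + 14 + 2 * K + 11 = 12 * T + (2 * nl + 2 * K + 25) by lia.
  rewrite mulnDr mulnCA -/T2 /a; have := hTl (2 * nl + 2 * K + 25).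
  rewrite [X in _ <= X * _ -> _]addnC [X in _ -> _ <= X * _](_ : _ = (2 * nl + 2 * K + 25) + 15); last by lia.
  by rewrite (addnC 25) mulnDl => h; lia.
have hU Cb : Cb <= 12 * T + 2 * nl + 14 -> U Cb <= nl * a * T3 + 10 * T3.
  move/hV => h; rewrite /U mulnDr -addnA; apply: leq_add; last by lia.
  rewrite /T3 mulnCA -mulnA leq_mul2l; apply/orP; right.
  by rewrite mulnCA leq_mul2l h orbT.
have hU1 : U 1 <= nl * a * T3 + 10 * T3 by apply: hU; lia.
have hU2 := hU _ (leqnn _).
rewrite -[T * (nl * (T * (1 + _ + _) + _) + _) + _]/(U 1).
rewrite -[T * (nl * (T * (12 * T + _ + _ + _ + _) + _) + _) + _]/(U (12 * T + 2 * nl + 14)).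
have hE' : size (edges w) <= nl * T3.
  by apply: (leq_trans hE); rewrite -mulnA mulnCA leq_mul2l h3 orbT.
have hq : 4 ^ D * T <= 4 ^ D * T3 by rewrite leq_mul2l (leq_trans h2 h3) orbT.
have hlast : T * (6 * T + 5 + 1).+2 <= 14 * T3.
  by rewrite -addn2 !mulnDr mulnCA -/T2; lia.
rewrite !mulnDl -!mulnA; rewrite -mulnA in hU1 hU2.
move: (U 1) (U _) hU1 hU2 hlast => u1 u2.
move: (T * _.+2) (nl * (a * T3)) (nl * T3) (4 ^ D * T3) (4 ^ D * T) hE' hq => t1 t2 t3 t4 t5; lia.
Qed.

End Main.

(** * Hardness *)

Lemma tower_mono k a b : a <= b -> tower k a <= tower k b.
Proof. by move=> h; elim: k => //= k IH; rewrite leq_exp2l. Qed.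

Lemma tower_ge k a : a <= tower k a.
Proof. by elim: k => //= k IH; apply: leq_trans IH (ltnW (ltn_expl _ _)). Qed.

(** On the left stand the input nodes, the constants, and enough atoms for both the space bound and
    an input row with a blank. The base [n + 2] is at least 2, so the exponent absorbs the constants
    even for short inputs. *)
Lemma poly_le_exp n c d K :
  n.+1 + K + (c * n ^ d + c + n.+2) <= n.+2 ^ (d + (2 * c + K + 4)).
Proof.
have h1 : n ^ d <= n.+2 ^ d by case: d => [|d] //; rewrite leq_exp2r // !leqW.
have h2 : 0 < n.+2 ^ d by rewrite expn_gt0.
rewrite expnD; move: (n.+2 ^ d) (n ^ d) h1 h2 => x y h1 h2.
have h3 : n.+2 * (2 * c + K + 3) <= n.+2 ^ (2 * c + K + 4).
  rewrite [_ + 4]addnS expnS leq_mul2l /=; apply: ltnW; apply: ltn_expl; lia.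
apply: (@leq_trans (x * (n.+2 * (2 * c + K + 3)))); last by rewrite leq_mul2l h3 orbT.
nia.
Qed.

(** From left to right any width will do; from right to left [W] is the number of all addresses. The
    first hypothesis says that the atoms [0] to [A - 1] exactly fill up the graph. *)
Lemma models_dgr (M : TM) (k0 D A : nat) (w : seq bool) :
  anode M k0.+1 w A = nnodes D w -> (size w).+2 <= A ->
  (forall t, c_head (run M w t) < tower k0.+1 A) ->
  models (dgr M k0.+1 D w) (wphi k0.+1) <-> exists t, c_st (run M w t) = tm_qacc M.
Proof.
move=> hA hn hh; set k := k0.+1.
have dkI : is_database (dgr M k D w) by move=> u v; apply: ord_inj.
have dEE a (u v : 'I_(dn (dgr M k D w))) :
    a < nlab k -> ((u, inord a, v) \in dE (dgr M k D w)) = edge M k w a u v.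
  by move=> ha; rewrite inE /= inordK.
rewrite (models_wphi dkI dEE); split=> [[p [_ /PhiS_tiling[m [W [tau /tiling_sound]]]]]|[t ht]] //.
pose W := tower k A.
have hW : (size w).+2 <= W := leq_trans hn (tower_ge k A).
have W0 : 0 < W by apply: leq_trans hW.
have tl := tiling_complete k hh hW ht.
set tau := ttau M k w W in tl; set m := t.+2 * W in tl.
have tlv j : k0 < lvl M k0 w (tau j) by apply: ttau_cell.
pose ws := cpath M k0 w A W m tau.
have hT j : tau j < nnodes D w.
  by rewrite -hA (leq_ltn_trans (ttau_le _ _ _ _ _)) // /anode !addSn ltnS leq_addr.
have wlt : all (fun u => u < nnodes D w) ws by apply: ws_lt => //; rewrite hA.
have wsz : 0 < size ws := size_ws W0 (leqnn _) tl.
have T0 : 0 < nnodes D w by apply: leq_ltn_trans (hT 0).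
pose u0 := Ordinal T0; pose vs : seq 'I_(nnodes D w) := map (insubd u0) ws.
have vsK : map val vs = ws.
  rewrite -map_comp -[RHS]map_id; apply/eq_in_map => u hu.
  by rewrite /= val_insubd (allP wlt _ hu).
pose p : gpath (dgr M k D w) := (head u0 vs, [seq (inord 0 : 'I_(nlab k), v) | v <- behead vs]).
have vsz : 0 < size vs by rewrite size_map.
exists p; split.
  rewrite /valid_path /p /=; elim: (behead vs) (head u0 vs) => //= v l IH u.
  by rewrite IH andbT inE /= inordK.
have -> : plen p = size ws.
  by rewrite /plen /p size_map -(size_map (insubd u0) ws) size_behead prednK.
(* At [i = 0] both sides are the first node, so the functions agree everywhere. *)
have -> : (fun i => node_at p i : nat) = (fun i => nth (head 0 ws) ws i.-1).
  apply: functional_extensionality => i; rewrite /node_at /p /=.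
  rewrite -map_comp map_id -vsK; case: (vs) vsz => // v l _ /=.
  case: i => [|[|i]] //=; rewrite subSS subn1 /=.
  by elim: l i => [|x l IH] [|i] //=.
exact: PhiS_complete.
Qed.

Theorem theorem4p1 :
  forall k : nat, 1 <= k ->
    exists (s : nat) (phi : wl s),
      boolean_wl phi /\ kEXPSPACE_hard_on_databases k phi.
Proof.
case=> // k0 _; set k := k0.+1.
exists (nlab k), (wphi k); split; first exact: boolean_wphi.
(* The machine enters only from here on: [K] and [D] shape the graph, while the formula is already
   fixed by [k]. *)
move=> L [M [c [d dec]]].
pose K := #|cst M k|; pose D := d + (2 * c + K + 4).
exists (fun w => enc (dgr M k D w)); split.
  have [|C [E hC]] := @pcost_le M k D; first by rewrite /D; lia.
  apply: (@prog_ptime _ (pmain M k D) C E) => w.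
  have [s [m [h1 h2 h3]]] := runs_pmain M k D w.
  exists s, m; split=> //; first exact: leq_trans h2 (hC w).
  by rewrite h3 enc_dgr.
move=> w; exists (dgr M k D w); split; first by move=> u v; apply: ord_inj.
split=> //; have [_ [hspace ->]] := dec w.
have hp := poly_le_exp (size w) c d K.
(* The nodes that remain for atoms after the input row and the constants. *)
set A := nnodes D w - ((size w).+1 + K).
have hA : c * size w ^ d + c + (size w).+2 <= A.
  by rewrite /A leq_subRL ?(leq_trans _ hp) // leq_addr.
apply: iff_sym; apply: (@models_dgr M k0 D A w).
- by rewrite /anode subnKC // (leq_trans _ hp) // leq_addr.
- by apply: leq_trans hA; rewrite leq_addl.
- move=> t; apply: leq_trans (hspace t) _; apply: tower_mono.
  by apply: leq_trans hA; rewrite leq_addr.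
Qed.
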